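(* Assume the consistency of ZFC + ''there is a cardinal $\kappa$ that is $\kappa^+$-supercompact''. Then there is a model of KMCU in which $\mathrm{RP}_2$ holds and Limitation of Size fails.
   Context: Urelement class theory is two-sorted: first-order variables range over sets and urelements (predicate $\mathcal{A}$, relation $\in$), second-order variables over classes. KMCU = ZU (urelements have no members, Extensionality for sets, Foundation, Pairing, Union, Powerset, Infinity, Separation: $Y\cap x$ is a set) + Class Extensionality + Replacement (image of a set under a class function is a set) + Full Comprehension (for every formula $\varphi$ possibly with class quantifiers and class parameters, $\{x:\varphi(x)\}$ is a class) + Global Well-Ordering (there is a class well-ordering of the universe). $\mathrm{RP}_2$ is the scheme $\forall X[\varphi(X)\to\exists t(t$ transitive $\wedge\varphi^t(X\cap t))]$ for every formula $\varphi$, where $\varphi^t$ restricts first-order quantifiers to members of $t$ and second-order quantifiers to subsets of $t$. Limitation of Size: all proper classes are equinumerous. $\kappa$ is $\kappa^+$-supercompact if there is a normal fine measure on $P_\kappa(\kappa^+)$. *)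

(* Defs.v *)
From Stdlib Require Import List Arith.
Import ListNotations.

Definition scons {A : Type} (a : A) (f : nat -> A) (n : nat) : A :=
  match n with 0 => a | S m => f m end.

(** * First-order logic with equality over the single binary relation [∈] *)

(** Variables are de Bruijn indices.  The language has no function symbols, so
    terms are variables and substitutions are renamings. *)
Inductive form : Type :=
| fBot
| fMem (x y : nat)
| fEq (x y : nat)
| fImp (p q : form)
| fAll (p : form).

Fixpoint rename (r : nat -> nat) (p : form) : form :=
  match p with
  | fBot => fBot
  | fMem x y => fMem (r x) (r y)
  | fEq x y => fEq (r x) (r y)
  | fImp p q => fImp (rename r p) (rename r q)
  | fAll p => fAll (rename (scons 0 (fun n => S (r n))) p)
  end.

Definition inst (x : nat) (p : form) : form := rename (scons x (fun n => n)) p.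

(** All free variables of [p] are [< n]. *)
Fixpoint bounded (n : nat) (p : form) : Prop :=
  match p with
  | fBot => True
  | fMem x y => x < n /\ y < n
  | fEq x y => x < n /\ y < n
  | fImp p q => bounded n p /\ bounded n q
  | fAll p => bounded (S n) p
  end.

(** Classical natural deduction. *)
Inductive prv : list form -> form -> Prop :=
| prv_hyp G p : In p G -> prv G p
| prv_impI G p q : prv (p :: G) q -> prv G (fImp p q)
| prv_impE G p q : prv G (fImp p q) -> prv G p -> prv G q
| prv_raa G p : prv (fImp p fBot :: G) fBot -> prv G p
| prv_allI G p : prv (map (rename S) G) p -> prv G (fAll p)
| prv_allE G p x : prv G (fAll p) -> prv G (inst x p)
| prv_eqI G x : prv G (fEq x x)
| prv_eqE G x y p : prv G (fEq x y) -> prv G (inst x p) -> prv G (inst y p).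

Definition theory := form -> Prop.

Definition provable (T : theory) (p : form) : Prop :=
  exists G, (forall q, In q G -> T q) /\ prv G p.

Definition consistent (T : theory) : Prop := ~ provable T fBot.

Definition extend (T : theory) (p : form) : theory := fun q => T q \/ q = p.

(** * Writing formulas with named binders *)

(** An [fm] is a formula as a function of the number [d] of binders above it.
    A bound variable is represented by its level (binders counted from the
    outermost one, starting at 0), and [idx d] turns a level into the de Bruijn
    index that denotes it below [d] binders. *)
Definition fm := nat -> form.

Definition idx (d x : nat) : nat := d - S x.

Definition bBot : fm := fun _ => fBot.
Definition bMem (x y : nat) : fm := fun d => fMem (idx d x) (idx d y).
Definition bEq (x y : nat) : fm := fun d => fEq (idx d x) (idx d y).
Definition bImp (p q : fm) : fm := fun d => fImp (p d) (q d).
Definition bAll (p : nat -> fm) : fm := fun d => fAll (p d (S d)).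

Definition bNot (p : fm) : fm := bImp p bBot.
Definition bAnd (p q : fm) : fm := bNot (bImp p (bNot q)).
Definition bOr (p q : fm) : fm := bImp (bNot p) q.
Definition bIff (p q : fm) : fm := bAnd (bImp p q) (bImp q p).
Definition bEx (p : nat -> fm) : fm := bNot (bAll (fun x => bNot (p x))).

Declare Scope fm_scope.
Delimit Scope fm_scope with fm.
Notation "x ∈ y" := (bMem x y) (at level 70, no associativity) : fm_scope.
Notation "x = y" := (bEq x y) : fm_scope.
Notation "~ p" := (bNot p) : fm_scope.
Notation "p /\ q" := (bAnd p q) : fm_scope.
Notation "p \/ q" := (bOr p q) : fm_scope.
Notation "p -> q" := (bImp p q) : fm_scope.
Notation "p <-> q" := (bIff p q) : fm_scope.
Notation "'All' x .. y , p" := (bAll (fun x => .. (bAll (fun y => p%fm)) ..))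
  (at level 200, x binder, y binder, right associativity) : fm_scope.
Notation "'Ex' x .. y , p" := (bEx (fun x => .. (bEx (fun y => p%fm)) ..))
  (at level 200, x binder, y binder, right associativity) : fm_scope.

(** [closure n p] is the universal closure of [p], whose parameters are the
    levels [0 .. n-1]. *)
Definition closure (n : nat) (p : fm) : form := Nat.iter n fAll (p n).

(** [app n p xs]: the de Bruijn formula [p] with its variables
    [0 .. length xs - 1] replaced by the levels [xs]; its remaining [n] variables
    are the parameters bound by [closure n]. *)
Definition app (n : nat) (p : form) (xs : list nat) : fm := fun d =>
  rename (fun i => if i <? length xs then idx d (nth i xs 0)
                   else i - length xs + (d - n)) p.

(** * Set-theoretic notions as formulas *)

Definition bUniq (p : nat -> fm) : fm :=
  (Ex y, p y /\ All z, p z -> z = y)%fm.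

Definition bEmpty (x : nat) : fm := (All z, ~ z ∈ x)%fm.
Definition bSub (x y : nat) : fm := (All z, z ∈ x -> z ∈ y)%fm.
(** [p = {x, y}] *)
Definition bUpair (p x y : nat) : fm := (All z, z ∈ p <-> z = x \/ z = y)%fm.
(** [p = {{x}, {x, y}}] *)
Definition bOpair (p x y : nat) : fm :=
  (Ex s t, bUpair s x x /\ bUpair t x y /\ bUpair p s t)%fm.
(** [⟨x, y⟩ ∈ f] *)
Definition bPairIn (x y f : nat) : fm := (Ex p, bOpair p x y /\ p ∈ f)%fm.

Definition bFun (f a b : nat) : fm :=
  ((All p, p ∈ f -> Ex x y, x ∈ a /\ y ∈ b /\ bOpair p x y) /\
   (All x, x ∈ a -> bUniq (fun y => bPairIn x y f)))%fm.
Definition bBij (f a b : nat) : fm :=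
  (bFun f a b /\ (All y, y ∈ b -> bUniq (fun x => bPairIn x y f)))%fm.

(** [s = x ∪ {x}] *)
Definition bSucc (s x : nat) : fm := (All z, z ∈ s <-> z ∈ x \/ z = x)%fm.
Definition bInductive (w : nat) : fm :=
  ((Ex e, bEmpty e /\ e ∈ w) /\
   (All x, x ∈ w -> Ex s, bSucc s x /\ s ∈ w))%fm.

(** [∈] is well-founded on every set by Foundation, so linearity suffices. *)
Definition bOrdinal (a : nat) : fm :=
  ((All x, x ∈ a -> bSub x a) /\
   (All x y, x ∈ a -> y ∈ a -> x ∈ y \/ x = y \/ y ∈ x))%fm.
Definition bCardinal (k : nat) : fm :=
  (bOrdinal k /\ All a, a ∈ k -> ~ Ex f, bBij f a k)%fm.
Definition bUncountableCardinal (k : nat) : fm :=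
  (bCardinal k /\ Ex w, bInductive w /\ w ∈ k)%fm.
(** [l = k⁺] *)
Definition bCardSucc (l k : nat) : fm :=
  (bCardinal l /\ k ∈ l /\ All m, m ∈ l -> bCardinal m -> ~ k ∈ m)%fm.
(** [|x| < k], for a cardinal [k] *)
Definition bCardLt (x k : nat) : fm := (Ex a, a ∈ k /\ Ex f, bBij f x a)%fm.

(** [P = P_k(l) = {x ⊆ l : |x| < k}] *)
Definition bPkl (P k l : nat) : fm := (All x, x ∈ P <-> bSub x l /\ bCardLt x k)%fm.

Definition bUltrafilter (U P : nat) : fm :=
  ((All Y, Y ∈ U -> bSub Y P) /\
   P ∈ U /\
   (All Y, bEmpty Y -> ~ Y ∈ U) /\
   (All Y Z, Y ∈ U -> bSub Y Z -> bSub Z P -> Z ∈ U) /\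
   (All Y Z I, Y ∈ U -> Z ∈ U -> (All x, x ∈ I <-> x ∈ Y /\ x ∈ Z) -> I ∈ U) /\
   (All Y Z, bSub Y P -> (All x, x ∈ Z <-> x ∈ P /\ ~ x ∈ Y) -> Y ∈ U \/ Z ∈ U))%fm.
Definition bNonprincipal (U : nat) : fm :=
  (All x s, bUpair s x x -> ~ s ∈ U)%fm.
Definition bComplete (U k : nat) : fm :=
  (All F I, bSub F U -> ~ bEmpty F -> bCardLt F k ->
     (All x, x ∈ I <-> All Y, Y ∈ F -> x ∈ Y) -> I ∈ U)%fm.
Definition bMeasure (U P k : nat) : fm :=
  (bUltrafilter U P /\ bNonprincipal U /\ bComplete U k)%fm.
Definition bFine (U P l : nat) : fm :=
  (All a, a ∈ l -> Ex Y, Y ∈ U /\ All x, x ∈ Y <-> x ∈ P /\ a ∈ x)%fm.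
(** If [f(x) ∈ x] for [U]-almost all [x], then [f] is constant [U]-almost
    everywhere. *)
Definition bNormal (U P l : nat) : fm :=
  (All f, bFun f P l ->
     (Ex Y, Y ∈ U /\ All x, x ∈ Y -> Ex y, bPairIn x y f /\ y ∈ x) ->
     Ex a, a ∈ l /\ Ex Y, Y ∈ U /\ All x, x ∈ Y -> bPairIn x a f)%fm.

(** There is a cardinal [k] that is [k⁺]-supercompact. *)
Definition supercompact_succ : form := closure 0
  (Ex k l P, bUncountableCardinal k /\ bCardSucc l k /\ bPkl P k l /\
     Ex U, bMeasure U P k /\ bFine U P l /\ bNormal U P l)%fm.

(** * ZFC *)

Definition ax_ext : form := closure 0
  (All x y, (All z, z ∈ x <-> z ∈ y) -> x = y)%fm.
Definition ax_found : form := closure 0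
  (All x, ~ bEmpty x -> Ex y, y ∈ x /\ All z, z ∈ x -> ~ z ∈ y)%fm.
Definition ax_pair : form := closure 0 (All x y, Ex p, bUpair p x y)%fm.
Definition ax_union : form := closure 0
  (All x, Ex u, All z, z ∈ u <-> Ex y, y ∈ x /\ z ∈ y)%fm.
Definition ax_power : form := closure 0
  (All x, Ex p, All y, y ∈ p <-> bSub y x)%fm.
Definition ax_inf : form := closure 0 (Ex w, bInductive w)%fm.
(** Every family of nonempty sets has a choice function. *)
Definition ax_choice : form := closure 0
  (All F, (All x, x ∈ F -> ~ bEmpty x) ->
     Ex f b, bFun f F b /\ All x y, x ∈ F -> bPairIn x y f -> y ∈ x)%fm.
Definition ax_sep (n : nat) (p : form) : form := closure n
  (All a, Ex b, All x, x ∈ b <-> x ∈ a /\ app n p [x])%fm.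
Definition ax_repl (n : nat) (p : form) : form := closure n
  (All a, (All x y z, x ∈ a -> app n p [x; y] -> app n p [x; z] -> y = z) ->
     Ex b, All y, y ∈ b <-> Ex x, x ∈ a /\ app n p [x; y])%fm.

Inductive ZFC : theory :=
| ZFC_ext : ZFC ax_ext
| ZFC_found : ZFC ax_found
| ZFC_pair : ZFC ax_pair
| ZFC_union : ZFC ax_union
| ZFC_power : ZFC ax_power
| ZFC_inf : ZFC ax_inf
| ZFC_choice : ZFC ax_choice
| ZFC_sep n p : bounded (1 + n) p -> ZFC (ax_sep n p)
| ZFC_repl n p : bounded (2 + n) p -> ZFC (ax_repl n p).

(** * Urelement class theory *)

(** Structures for the two-sorted language: [ur] is the urelement predicate,
    [mem] is membership between objects, [cmem] membership of an object in a
    class. *)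
Record ustruct : Type := {
  obj : Type;
  cls : Type;
  ur : obj -> Prop;
  mem : obj -> obj -> Prop;
  cmem : obj -> cls -> Prop }.

Arguments ur {_} _.
Arguments mem {_} _ _.
Arguments cmem {_} _ _.

(** Formulas of the two-sorted language, with one family of de Bruijn indices for
    each sort ([uAll] binds a first-order, [uCAll] a class variable). *)
Inductive uform : Type :=
| uBot
| uUr (x : nat)
| uMem (x y : nat)
| uEq (x y : nat)
| uCMem (x X : nat)
| uCEq (X Y : nat)
| uImp (p q : uform)
| uAll (p : uform)
| uCAll (p : uform).

(** Free first-order variables are [< n] and free class variables are [< m]. *)
Fixpoint ubounded (n m : nat) (p : uform) : Prop :=
  match p with
  | uBot => True
  | uUr x => x < n
  | uMem x y => x < n /\ y < n
  | uEq x y => x < n /\ y < n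
  | uCMem x X => x < n /\ X < m
  | uCEq X Y => X < m /\ Y < m
  | uImp p q => ubounded n m p /\ ubounded n m q
  | uAll p => ubounded (S n) m p
  | uCAll p => ubounded n (S m) p
  end.

Section Semantics.

Variable M : ustruct.

(** Satisfaction with first-order quantifiers restricted to [D] and class
    quantifiers restricted to [C]. *)
Fixpoint usat_in (D : obj M -> Prop) (C : cls M -> Prop) (p : uform)
    (r : nat -> obj M) (s : nat -> cls M) : Prop :=
  match p with
  | uBot => False
  | uUr x => ur (r x)
  | uMem x y => mem (r x) (r y)
  | uEq x y => r x = r y
  | uCMem x X => cmem (r x) (s X)
  | uCEq X Y => s X = s Y
  | uImp p q => usat_in D C p r s -> usat_in D C q r s
  | uAll p => forall a, D a -> usat_in D C p (scons a r) s
  | uCAll p => forall A, C A -> usat_in D C p r (scons A s)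
  end.

Definition usat : uform -> (nat -> obj M) -> (nat -> cls M) -> Prop :=
  usat_in (fun _ => True) (fun _ => True).

(** Truth of [φ^t]. *)
Definition usat_rel (t : obj M) : uform -> (nat -> obj M) -> (nat -> cls M) -> Prop :=
  usat_in (fun x => mem x t) (fun X => forall x, cmem x X -> mem x t).

Definition is_set (x : obj M) : Prop := ~ ur x.

Definition upair (p x y : obj M) : Prop := forall z, mem z p <-> z = x \/ z = y.
Definition opair (p x y : obj M) : Prop :=
  exists s t, upair s x x /\ upair t x y /\ upair p s t.
Definition cpair (x y : obj M) (F : cls M) : Prop := exists p, opair p x y /\ cmem p F.

Definition class_rel (F : cls M) : Prop :=
  forall p, cmem p F -> exists x y, opair p x y.
Definition class_fun (F : cls M) : Prop :=
  class_rel F /\ forall x y z, cpair x y F -> cpair x z F -> y = z.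

(** [W] is a strict well-ordering of the universe. *)
Definition class_wo (W : cls M) : Prop :=
  class_rel W /\
  (forall x, ~ cpair x x W) /\
  (forall x y z, cpair x y W -> cpair y z W -> cpair x z W) /\
  (forall x y, cpair x y W \/ x = y \/ cpair y x W) /\
  (forall X, (exists x, cmem x X) ->
     exists x, cmem x X /\ forall y, cmem y X -> ~ cpair y x W).

Record ZU : Prop := {
  zu_ur : forall a x : obj M, ur a -> ~ mem x a;
  zu_ext : forall x y : obj M, is_set x -> is_set y ->
    (forall z, mem z x <-> mem z y) -> x = y;
  zu_found : forall x : obj M, (exists y, mem y x) ->
    exists y, mem y x /\ forall z, mem z x -> ~ mem z y;
  zu_pair : forall x y : obj M, exists p, is_set p /\ upair p x y;
  zu_union : forall x : obj M, exists u, is_set u /\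
    forall z, mem z u <-> exists y, mem y x /\ mem z y;
  zu_power : forall x : obj M, exists p, is_set p /\
    forall y, mem y p <-> is_set y /\ forall z, mem z y -> mem z x;
  zu_inf : exists w : obj M, is_set w /\
    (exists e, is_set e /\ (forall z, ~ mem z e) /\ mem e w) /\
    (forall x, mem x w ->
       exists s, (forall z, mem z s <-> mem z x \/ z = x) /\ mem s w);
  zu_sep : forall (x : obj M) (Y : cls M), exists y, is_set y /\
    forall z, mem z y <-> mem z x /\ cmem z Y }.

Record KMCU : Prop := {
  km_zu : ZU;
  km_cext : forall X Y : cls M, (forall x, cmem x X <-> cmem x Y) -> X = Y;
  km_repl : forall (F : cls M) (x : obj M), class_fun F -> exists y, is_set y /\
    forall z, mem z y <-> exists w, mem w x /\ cpair w z F;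
  km_compr : forall (p : uform) (r : nat -> obj M) (s : nat -> cls M),
    exists X, forall x, cmem x X <-> usat p (scons x r) s;
  km_gwo : exists W, class_wo W }.

Definition transitive_set (t : obj M) : Prop :=
  is_set t /\ forall x y, mem x t -> mem y x -> mem y t.

(** The only free variable of [p] is the class variable [0], so the valuations [r]
    and [s] play no role. *)
Definition RP2 : Prop :=
  forall p, ubounded 0 1 p -> forall r s X, usat p r (scons X s) ->
  exists t, transitive_set t /\
  exists Y, (forall x, cmem x Y <-> cmem x X /\ mem x t) /\
            usat_rel t p r (scons Y s).

Definition proper_class (X : cls M) : Prop :=
  ~ exists x, is_set x /\ forall z, mem z x <-> cmem z X.

Definition equinumerous (X Y : cls M) : Prop :=
  exists F, class_fun F /\
    (forall x, cmem x X <-> exists y, cpair x y F) /\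
    (forall y, cmem y Y <-> exists x, cpair x y F) /\
    (forall x x' y, cpair x y F -> cpair x' y F -> x = x').

Definition LimitationOfSize : Prop :=
  forall X Y, proper_class X -> proper_class Y -> equinumerous X Y.

End Semantics.

(* Main.v *)
From Stdlib Require Import List Arith Lia Cantor Classical ClassicalEpsilon.
From Stdlib Require Import FunctionalExtensionality PropExtensionality.
Require Import Defs.
Import ListNotations.

(** By completeness there is a model [N] of ZFC with a normal fine measure [U] on
    [P = P_k(l)], [l = k⁺].  As [k] is inaccessible, choice gives an
    injection [s : P → l]; it can be chosen with [x ⊆ s(x)], and with [s(a) = a] for
    [a ∈ k].  The objects of the urelement model are the elements of [l], its classes
    the subsets of [l]; [s(x)] is the set with elements [x], and what is not a value of
    [s] is an urelement.  So the sets are exactly the collections of size [< k], whence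
    KMCU, while the proper classes [k] and [l] have different sizes.  RP2 is Łoś's
    theorem: a second-order formula holds of [l] iff for [U]-almost all [z ∈ P] it holds
    of [z], and [s(z)] is transitive for almost all [z]. *)

(** * Completeness of natural deduction *)

(** The model [N] is arbitrary and possibly ill-founded, so a collection of its elements is known to
    be a set of [N] only if it is definable. Every construction inside [N] therefore carries a proof
    of definability with parameters ([Df], [Tm]), normally found by the tactic [df]. Classes of the
    urelement model are elements of [N], so a second-order formula over [l] becomes first-order over
    [N]. This yields Full Comprehension by separation, and it lets the ultrafilter decide each
    formula, so that Łoś's theorem is proved without forming an ultrapower. The successor [k⁺] is
    large enough to leave two sizes of proper classes and small enough that [P] still injects into
    [l]. That injection rests on cardinal arithmetic ([k] regular and strong limit, [l] regular),
    for which the measure supplies the facts about [k]. The two side conditions on [s] serve single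
    axioms: [x ⊆ s(x)] gives Foundation, and [s(a) = a] below [k] keeps an inductive set, hence
    Infinity. Transitivity of almost all [s(z)] and the quantifier steps of Łoś's theorem both come
    from closure under diagonal intersections, which is normality. *)

Fixpoint free (x : nat) (p : form) : Prop :=
  match p with
  | fBot => False
  | fMem a b => x = a \/ x = b
  | fEq a b => x = a \/ x = b
  | fImp p q => free x p \/ free x q
  | fAll p => free (S x) p
  end.

Definition up (r : nat -> nat) : nat -> nat := scons 0 (fun n => S (r n)).

Lemma rename_ext r r' p :
  (forall x, free x p -> r x = r' x) -> rename r p = rename r' p.
Proof.
  revert r r'; induction p as [|a b|a b|p IHp q IHq|p IHp]; intros r r' H;
    simpl in *; f_equal; auto.
  apply IHp; intros [|x] Hx; simpl; auto.
Qed.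

Lemma rename_rename r r' p :
  rename r (rename r' p) = rename (fun n => r (r' n)) p.
Proof.
  revert r r'; induction p as [|a b|a b|p IHp q IHq|p IHp]; intros r r';
    simpl; f_equal; auto.
  rewrite IHp; apply rename_ext; intros [|x] _; reflexivity.
Qed.

Lemma rename_id p : rename (fun n => n) p = p.
Proof.
  induction p as [|a b|a b|p IHp q IHq|p IHp]; simpl; f_equal; auto.
  rewrite <- IHp at 2; apply rename_ext; intros [|x] _; reflexivity.
Qed.

Lemma free_rename r p x : free x (rename r p) -> exists y, free y p /\ x = r y.
Proof.
  revert r x; induction p as [|a b|a b|p IHp q IHq|p IHp]; intros r x; simpl.
  - tauto.
  - intros [->| ->]; eauto.
  - intros [->| ->]; eauto.
  - intros [H|H]; [apply IHp in H|apply IHq in H]; destruct H as (y & ? & ?); eauto.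
  - intros H; apply IHp in H; destruct H as ([|y] & Hy & E); simpl in E;
      [discriminate|]; injection E as ->; eauto.
Qed.

Lemma free_bound p : exists n, forall x, free x p -> x < n.
Proof.
  induction p as [|a b|a b|p [n Hn] q [m Hm]|p [n Hn]]; simpl.
  - exists 0; tauto.
  - exists (S (a + b)); lia.
  - exists (S (a + b)); lia.
  - exists (n + m); intros x [H|H]; [apply Hn in H|apply Hm in H]; lia.
  - exists n; intros x H; apply Hn in H; lia.
Qed.

Lemma free_bound_list (G : list form) :
  exists n, forall p, In p G -> forall x, free x p -> x < n.
Proof.
  induction G as [|p G [n Hn]]; [exists 0; simpl; tauto|].
  destruct (free_bound p) as [m Hm]; exists (n + m).
  intros q [<-|H] x Hx; [apply Hm in Hx|apply (Hn q) in Hx]; auto; lia.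
Qed.

(** Arbitrary renamings are allowed, injective or not: [completeness] applies this to [Nat.div2]. *)
Lemma prv_rename G p : prv G p -> forall r, prv (map (rename r) G) (rename r p).
Proof.
  induction 1 as [G p H|G p q _ IH|G p q _ IH1 _ IH2|G p _ IH|G p _ IH|G p x _ IH
    |G x|G x y p _ IH1 _ IH2]; intros r.
  - apply prv_hyp, in_map, H.
  - apply prv_impI, IH.
  - exact (prv_impE _ _ _ (IH1 r) (IH2 r)).
  - apply prv_raa, IH.
  - apply prv_allI. specialize (IH (up r)). rewrite map_map in *.
    erewrite map_ext; [exact IH|]. intros q; simpl; rewrite !rename_rename; reflexivity.
  - replace (rename r (inst x p)) with (inst (r x) (rename (up r) p)).
    + apply prv_allE, IH.
    + unfold inst; rewrite !rename_rename; apply rename_ext; intros [|n] _; reflexivity.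
  - apply prv_eqI.
  - assert (E : forall z, rename r (inst z p) = inst (r z) (rename (up r) p)).
    { intros z; unfold inst; rewrite !rename_rename; apply rename_ext.
      intros [|n] _; reflexivity. }
    rewrite E in *; eapply prv_eqE; [apply IH1|rewrite <- E; apply IH2].
Qed.

Lemma prv_weak G p : prv G p -> forall G', incl G G' -> prv G' p.
Proof.
  induction 1 as [G p H|G p q _ IH|G p q _ IH1 _ IH2|G p _ IH|G p _ IH|G p x _ IH
    |G x|G x y p _ IH1 _ IH2]; intros G' I.
  - apply prv_hyp; auto.
  - apply prv_impI, IH. intros q' [<-|]; simpl; auto.
  - exact (prv_impE _ _ _ (IH1 _ I) (IH2 _ I)).
  - apply prv_raa, IH. intros q' [<-|]; simpl; auto.
  - apply prv_allI, IH, incl_map, I.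
  - apply prv_allE; auto.
  - apply prv_eqI.
  - eapply prv_eqE; eauto.
Qed.

Lemma provable_weak (T T' : theory) p :
  (forall q, T q -> T' q) -> provable T p -> provable T' p.
Proof. intros H (G & HG & D); exists G; split; auto. Qed.

Lemma provable_mp T p q : provable T (fImp p q) -> provable T p -> provable T q.
Proof.
  intros (G & HG & D) (G' & HG' & D'); exists (G ++ G'); split.
  - intros r Hr; apply in_app_or in Hr; destruct Hr; auto.
  - apply prv_impE with p.
    + apply (prv_weak _ _ D), incl_appl, incl_refl.
    + apply (prv_weak _ _ D'), incl_appr, incl_refl.
Qed.

Lemma provable_hyp (T : theory) p : T p -> provable T p.
Proof.
  intros H; exists [p]; split; [intros q [<-|[]]; auto|apply prv_hyp; simpl; auto].
Qed.

Lemma provable_closed T p : prv [] p -> provable T p.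
Proof. intros H; exists []; split; [intros q []|exact H]. Qed.

Lemma provable_deduction T p q :
  provable (extend T p) q -> provable T (fImp p q).
Proof.
  intros (G & HG & D).
  (* Deleting all occurrences of [p] leaves hypotheses from [T]; equality of formulas is decided
     classically. *)
  exists (filter (fun r => if excluded_middle_informative (r = p) then false else true) G).
  split.
  - intros r Hr; apply filter_In in Hr as [Hr Hr'].
    destruct (excluded_middle_informative (r = p)); [discriminate|].
    destruct (HG r Hr); tauto.
  - apply prv_impI, (prv_weak _ _ D); intros r Hr.
    destruct (excluded_middle_informative (r = p)) as [->|n]; [simpl; auto|right].
    apply filter_In; split; auto.
    destruct (excluded_middle_informative (r = p)); tauto.
Qed.

Definition neg (p : form) : form := fImp p fBot.

Lemma provable_neg T p : ~ consistent (extend T p) -> provable T (neg p).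
Proof. intros H; apply NNPP in H; apply provable_deduction, H. Qed.

(* A proof of [q(c)] with [c] fresh is turned into a proof of [∀ q] by the renaming
   that sends [c] to [0] and shifts everything else. *)
Lemma consistent_henkin (T : theory) (q : form) (c : nat) :
  consistent T -> (forall p, T p -> ~ free c p) -> ~ free (S c) q ->
  consistent (extend T (fImp (inst c q) (fAll q))).
Proof.
  intros HT Hf Hq H.
  assert (H' : provable T (neg (fImp (inst c q) (fAll q)))) by
    (apply provable_deduction, H).
  assert (H1 : provable T (inst c q)).
  { refine (provable_mp _ _ _ _ H'); apply provable_closed, prv_impI, prv_raa.
    eapply prv_impE; [apply prv_hyp; right; left; reflexivity|].
    apply prv_impI, prv_raa.
    eapply prv_impE; [apply prv_hyp; do 2 right; left; reflexivity|].
    apply prv_hyp; simpl; auto. }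
  assert (H2 : provable T (fAll q)).
  { destruct H1 as (G & HG & D); exists G; split; auto.
    apply prv_allI.
    pose (r := fun n => if Nat.eq_dec n c then 0 else S n).
    apply (prv_rename _ _) with (r := r) in D.
    replace (map (rename r) G) with (map (rename S) G) in D.
    - replace (rename r (inst c q)) with q in D; auto.
      unfold inst; rewrite rename_rename, <- (rename_id q) at 1.
      apply rename_ext; intros [|x] Hx; unfold r; simpl.
      + destruct (Nat.eq_dec c c); congruence.
      + destruct (Nat.eq_dec x c); congruence.
    - apply map_ext_in; intros p Hp; apply rename_ext; intros x Hx; unfold r.
      destruct (Nat.eq_dec x c); subst; auto; destruct (Hf p); auto. }
  apply HT; refine (provable_mp _ _ _ H' _).
  refine (provable_mp _ _ _ _ H2); apply provable_closed, prv_impI, prv_impI.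
  apply prv_hyp; simpl; auto.
Qed.

(** * Enumeration of the formulas *)

Definition pcode (x y : nat) : nat := to_nat (x, y).

Lemma pcode_inj x y x' y' : pcode x y = pcode x' y' -> x = x' /\ y = y'.
Proof.
  intros H; assert (E : (x, y) = (x', y')).
  { rewrite <- (cancel_of_to (x, y)), <- (cancel_of_to (x', y')); f_equal; exact H. }
  inversion E; auto.
Qed.

Fixpoint code (p : form) : nat :=
  match p with
  | fBot => pcode 0 0
  | fMem x y => pcode 1 (pcode x y)
  | fEq x y => pcode 2 (pcode x y)
  | fImp p q => pcode 3 (pcode (code p) (code q))
  | fAll p => pcode 4 (code p)
  end.

Lemma code_inj p q : code p = code q -> p = q.
Proof.
  revert q; induction p as [|a b|a b|p IHp p' IHp'|p IHp];
    intros [|c d|c d|q q'|q] H; cbn [code] in H; apply pcode_inj in H as [H H'];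
    try discriminate H; try reflexivity; try (apply pcode_inj in H' as [H1 H2]);
    f_equal; auto.
Qed.

(** A number that codes nothing yields an unspecified formula; it is enough that every formula is
    reached at its own code. *)
Definition decode (n : nat) : form :=
  epsilon (inhabits fBot) (fun p => code p = n).

Lemma decode_code p : decode (code p) = p.
Proof.
  apply code_inj; unfold decode.
  apply (epsilon_spec (inhabits fBot) (fun q => code q = code p)); eauto.
Qed.

(** * Henkin's complete extension of a consistent theory *)

Section Henkin.

Variable T : theory.
Hypothesis HT : consistent T.
(* leaves infinitely many variables for Henkin witnesses *)
Hypothesis Teven : forall p x, T p -> free x p -> Nat.Even x.

Definition add (G : list form) : theory := fun q => T q \/ In q G.

(** Only finitely many formulas have been added to [T], whose variables are even, so any large odd
    variable is fresh. In [q], which stands below a quantifier, it appears as [S c]. *)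
Lemma fresh_witness (G : list form) (q : form) :
  exists c, (forall p, add G p -> ~ free c p) /\ ~ free (S c) q.
Proof.
  destruct (free_bound_list (q :: G)) as [n Hn]; exists (S (2 * n)); split.
  - intros p [Hp|Hp] Hf.
    + destruct (Teven _ _ Hp Hf); lia.
    + apply Hn in Hf; simpl; auto; lia.
  - intros Hf; apply Hn in Hf; simpl; auto; lia.
Qed.

Definition decide (G : list form) (q : form) : list form :=
  if excluded_middle_informative (consistent (add (q :: G))) then q :: G else G.

Definition witness (G : list form) (q : form) : nat :=
  epsilon (inhabits 0) (fun c => (forall p, add G p -> ~ free c p) /\ ~ free (S c) q).

(** The enumerated formula serves twice: it is decided as a sentence of the theory, and as the body
    of [fAll q] it receives a Henkin axiom. The witness is chosen after the decision, so it is fresh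
    for the formula just added. *)
Fixpoint stage (n : nat) : list form :=
  match n with
  | 0 => []
  | S n => let q := decode n in
           let G := decide (stage n) q in
           fImp (inst (witness G q) q) (fAll q) :: G
  end.

Definition limit : theory := fun q => exists n, add (stage n) q.

Lemma add_cons G q r : add (q :: G) r <-> extend (add G) q r.
Proof. unfold add, extend; simpl; intuition. Qed.

Lemma consistent_ext (S S' : theory) :
  (forall q, S' q -> S q) -> consistent S -> consistent S'.
Proof. intros H HS HS'; apply HS; revert HS'; apply provable_weak, H. Qed.

Lemma stage_consistent n : consistent (add (stage n)).
Proof.
  induction n as [|n IH].
  - apply consistent_ext with T; auto; intros q [Hq|[]]; auto.
  - simpl; set (q := decode n); set (G := decide (stage n) q).
    assert (HG : consistent (add G)).
    { unfold G, decide; destruct (excluded_middle_informative _); auto. }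
    eapply consistent_ext; [intros r; apply add_cons|].
    unfold witness; destruct (epsilon_spec (inhabits 0) _ (fresh_witness G q)) as [H1 H2].
    apply consistent_henkin; auto.
Qed.

Lemma stage_mono n m : n <= m -> incl (stage n) (stage m).
Proof.
  induction 1 as [|m _ IH]; [apply incl_refl|].
  intros q Hq; right; unfold decide.
  destruct (excluded_middle_informative _); simpl; auto.
Qed.

Lemma limit_provable p : provable limit p -> exists n, provable (add (stage n)) p.
Proof.
  intros (G & HG & D).
  assert (H : exists n, forall q, In q G -> add (stage n) q).
  { clear D; induction G as [|q G IH]; [exists 0; intros q []|].
    destruct IH as [n Hn]; [intros; apply HG; simpl; auto|].
    destruct (HG q) as [m Hm]; [simpl; auto|].
    exists (n + m); intros r [<-|Hr].
    - destruct Hm; [left; auto|right; apply (stage_mono m); auto; lia].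
    - destruct (Hn r Hr); [left; auto|right; apply (stage_mono n); auto; lia]. }
  destruct H as [n Hn]; exists n, G; auto.
Qed.

Lemma limit_consistent : consistent limit.
Proof. intros H; apply limit_provable in H as [n H]; exact (stage_consistent n H). Qed.

Lemma limit_complete p : provable limit p \/ provable limit (neg p).
Proof.
  set (n := code p).
  destruct (classic (consistent (add (p :: stage n)))) as [H|H].
  - left; apply provable_hyp; exists (S n); right; simpl; right.
    unfold n at 2; rewrite decode_code; unfold decide.
    destruct (excluded_middle_informative _); [simpl; auto|contradiction].
  - right; apply provable_weak with (add (stage n)); [intros q Hq; exists n; exact Hq|].
    apply provable_neg; intros H'; apply H.
    eapply consistent_ext; [intros r; apply add_cons|exact H'].
Qed.

Lemma limit_all q : (forall c, provable limit (inst c q)) -> provable limit (fAll q).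
Proof.
  intros H; set (n := code q).
  set (c := witness (decide (stage n) q) q).
  apply provable_mp with (inst c q); auto.
  apply provable_hyp; exists (S n); right; simpl; left.
  unfold n, c; rewrite decode_code; reflexivity.
Qed.

Lemma limit_imp p q :
  provable limit (fImp p q) <-> (provable limit p -> provable limit q).
Proof.
  split; [apply provable_mp|intros H].
  destruct (limit_complete p) as [Hp|Hp].
  - refine (provable_mp _ _ _ _ (H Hp)); apply provable_closed, prv_impI, prv_impI.
    apply prv_hyp; simpl; auto.
  - refine (provable_mp _ _ _ _ Hp); apply provable_closed, prv_impI, prv_impI, prv_raa.
    eapply prv_impE with p; apply prv_hyp; simpl; auto.
Qed.

Lemma limit_subst x y p :
  provable limit (fEq x y) -> provable limit (inst x p) -> provable limit (inst y p).
Proof.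
  intros H H'.
  assert (D : prv [] (fImp (fEq x y) (fImp (inst x p) (inst y p)))).
  { do 2 apply prv_impI; eapply prv_eqE with x; apply prv_hyp; simpl; auto. }
  exact (provable_mp _ _ _ (provable_mp _ _ _ (provable_closed _ _ D) H) H').
Qed.

Definition teq (x y : nat) : Prop := provable limit (fEq x y).

Lemma teq_refl x : teq x x.
Proof. apply provable_closed, prv_eqI. Qed.

Lemma teq_sym x y : teq x y -> teq y x.
Proof.
  intros H; apply (limit_subst x y (fEq 0 (S x)) H), teq_refl.
Qed.

Lemma teq_trans x y z : teq x y -> teq y z -> teq x z.
Proof.
  intros H H'; apply (limit_subst y z (fEq (S x) 0) H'), H.
Qed.

Lemma tmem_teq x x' y y' : teq x x' -> teq y y' ->
  provable limit (fMem x y) -> provable limit (fMem x' y').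
Proof.
  intros H H' H''.
  apply (limit_subst y y' (fMem (S x') 0) H').
  apply (limit_subst x x' (fMem 0 (S y)) H), H''.
Qed.

(** Canonical representatives replace a quotient: provably equal variables have the same predicate
    [teq x] by extensionality, so [epsilon] picks the same element for them. *)
Definition rep (x : nat) : nat := epsilon (inhabits 0) (teq x).

Lemma teq_rep x : teq x (rep x).
Proof. exact (epsilon_spec (inhabits 0) (teq x) (ex_intro _ x (teq_refl x))). Qed.

Lemma rep_eq x y : teq x y -> rep x = rep y.
Proof.
  intros H; unfold rep; f_equal; apply functional_extensionality; intros z.
  apply propositional_extensionality; split; intros H'.
  - apply teq_trans with x; auto; apply teq_sym, H.
  - apply teq_trans with y; auto.
Qed.

Definition term_model : Type := { x : nat | rep x = x }.

Definition value (x : nat) : term_model :=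
  exist _ (rep x) (rep_eq _ _ (teq_sym _ _ (teq_rep x))).

Lemma value_eq x y : value x = value y <-> teq x y.
Proof.
  split; intros H.
  - injection H as H; apply teq_trans with (rep x); [apply teq_rep|].
    rewrite H; apply teq_sym, teq_rep.
  - apply eq_sig_hprop; [intros; apply proof_irrelevance|apply rep_eq, H].
Qed.

Lemma value_surj a : exists x, a = value x.
Proof.
  destruct a as [x Hx]; exists x; apply eq_sig_hprop;
    [intros; apply proof_irrelevance|symmetry; exact Hx].
Qed.

End Henkin.

(** * Satisfaction and the term model *)

Fixpoint sat {N : Type} (E : N -> N -> Prop) (p : form) (rho : nat -> N) : Prop :=
  match p with
  | fBot => False
  | fMem x y => E (rho x) (rho y)
  | fEq x y => rho x = rho y
  | fImp p q => sat E p rho -> sat E q rho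
  | fAll p => forall a, sat E p (scons a rho)
  end.

Lemma sat_ext {N} (E : N -> N -> Prop) p rho rho' :
  (forall x, free x p -> rho x = rho' x) -> sat E p rho <-> sat E p rho'.
Proof.
  revert rho rho'; induction p as [|a b|a b|p IHp q IHq|p IHp]; intros rho rho' H;
    simpl in *.
  - tauto.
  - rewrite !H by auto; tauto.
  - rewrite !H by auto; tauto.
  - rewrite (IHp rho rho'), (IHq rho rho') by auto; tauto.
  - split; intros Ha a; specialize (Ha a); revert Ha; apply IHp;
      intros [|x] Hx; simpl; auto; symmetry; auto.
Qed.

Lemma sat_rename {N} (E : N -> N -> Prop) p r rho :
  sat E (rename r p) rho <-> sat E p (fun n => rho (r n)).
Proof.
  revert r rho; induction p as [|a b|a b|p IHp q IHq|p IHp]; intros r rho; simpl;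
    try tauto.
  - rewrite IHp, IHq; tauto.
  - split; intros H a; specialize (H a); [apply IHp in H|apply IHp];
      revert H; apply sat_ext; intros [|x] _; reflexivity.
Qed.

(** The induction runs over all renamings [r], because the quantifier step sends the bound variable
    to an arbitrary variable, and variables name all elements of the term model. Henkin axioms enter
    through [limit_all]. *)
Lemma henkin_truth (T : theory) (HT : consistent T)
    (Teven : forall p x, T p -> free x p -> Nat.Even x) p r :
  sat (fun a b => provable (limit T) (fMem (proj1_sig a) (proj1_sig b))) p
      (fun n => value T (r n)) <-> provable (limit T) (rename r p).
Proof.
  revert r; induction p as [|a b|a b|p IHp q IHq|p IHp]; intros r; simpl.
  - split; [tauto|apply limit_consistent; auto].
  - split; apply tmem_teq; try apply teq_rep; apply teq_sym, teq_rep.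
  - apply value_eq.
  - rewrite IHp, IHq; symmetry; apply limit_imp.
  - assert (E : forall x, sat (fun a b => provable (limit T) (fMem (proj1_sig a) (proj1_sig b)))
        p (scons (value T x) (fun n => value T (r n))) <->
        provable (limit T) (inst x (rename (up r) p))).
    { intros x; unfold inst; rewrite rename_rename.
      rewrite (rename_ext _ (scons x r)) by (intros [|y] _; reflexivity).
      rewrite <- IHp; apply sat_ext; intros [|y] _; reflexivity. }
    split; intros H.
    + apply limit_all; intros x; apply E, H.
    + intros a; destruct (value_surj T a) as [x ->]; apply E.
      destruct H as (G & HG & D); exists G; split; auto; apply prv_allE, D.
Qed.

Theorem completeness (T : theory) : consistent T ->
  exists (N : Type) (E : N -> N -> Prop) (rho : nat -> N), forall p, T p -> sat E p rho.
Proof.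
  intros HT.
  (* Doubling the variables frees the odd ones for witnesses. Halving turns a refutation of [T']
     back into one of [T]. *)
  set (T' := fun q => exists p, T p /\ q = rename (fun n => 2 * n) p).
  assert (HT' : consistent T').
  { intros (G & HG & D); apply HT.
    apply (prv_rename _ _) with (r := Nat.div2) in D.
    exists (map (rename Nat.div2) G); split; auto.
    intros q Hq; apply in_map_iff in Hq as (q' & <- & Hq').
    destruct (HG _ Hq') as (p & Hp & ->).
    rewrite rename_rename, (rename_ext _ (fun n => n)), rename_id; auto.
    intros x _; apply Nat.div2_double. }
  assert (Teven : forall p x, T' p -> free x p -> Nat.Even x).
  { intros p x (q & _ & ->) Hx; apply free_rename in Hx as (y & _ & ->); exists y; auto. }
  exists (term_model T').
  exists (fun a b => provable (limit T') (fMem (proj1_sig a) (proj1_sig b))).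
  exists (fun n => value T' (2 * n)); intros p Hp.
  apply (henkin_truth T' HT' Teven), provable_hyp; exists 0; left; exists p; auto.
Qed.

Section ZFCModel.

Variable N : Type.
Variable E : N -> N -> Prop.
Variable rho0 : nat -> N.
Hypothesis zfc_true : forall p, ZFC p -> sat E p rho0.

Local Notation "x ∈ y" := (E x y) (at level 70, no associativity).

(** ** Definability with parameters *)

(* [σ] says which variables of the formula are read off the environment and which
   are parameters. *)
Definition look (σ : nat -> nat + N) (ρ : nat -> N) : nat -> N :=
  fun i => match σ i with inl j => ρ j | inr c => c end.

Definition Df (P : (nat -> N) -> Prop) : Prop :=
  exists p σ, forall ρ, P ρ <-> sat E p (look σ ρ).

(** A term is definable when its graph is; the value sits in variable 0 and pushes the arguments up
    by one. *)
Definition Tm (t : (nat -> N) -> N) : Prop :=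
  Df (fun ρ => ρ 0 = t (fun n => ρ (S n))).

Lemma Df_iff P Q : (forall ρ, P ρ <-> Q ρ) -> Df P -> Df Q.
Proof. intros H (p & σ & Hp); exists p, σ; intros ρ; rewrite <- H; apply Hp. Qed.

(** Classically, a proposition independent of the environment is a truth value, so statements of the
    metatheory may occur as parameters. *)
Lemma Df_const (P : Prop) : Df (fun _ => P).
Proof.
  destruct (classic P) as [H|H].
  - exists (neg fBot), inl; intros ρ; simpl; tauto.
  - exists fBot, inl; intros ρ; simpl; tauto.
Qed.

(** The two formulas have separate parameter assignments; these are merged by giving the even
    variables to one and the odd variables to the other. *)
Lemma Df_imp P Q : Df P -> Df Q -> Df (fun ρ => P ρ -> Q ρ).
Proof.
  intros (p & σ & Hp) (q & τ & Hq).
  exists (fImp (rename (fun i => 2 * i) p) (rename (fun i => S (2 * i)) q)).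
  pose (ω := fun i => if Nat.even i then σ (Nat.div2 i) else τ (Nat.div2 i)).
  exists ω; intros ρ; cbn [sat]; rewrite !sat_rename, Hp, Hq.
  rewrite (sat_ext E p (look σ ρ) (fun n => look ω ρ (2 * n))),
    (sat_ext E q (look τ ρ) (fun n => look ω ρ (S (2 * n)))); [reflexivity| |];
    intros x _; unfold look, ω.
  - rewrite Nat.even_succ, Nat.odd_mul, Nat.div2_succ_double; reflexivity.
  - rewrite Nat.even_mul, Nat.div2_double; reflexivity.
Qed.

Lemma Df_all (Q : (nat -> N) -> N -> Prop) :
  Df (fun ρ => Q (fun n => ρ (S n)) (ρ 0)) -> Df (fun ρ => forall x, Q ρ x).
Proof.
  intros (p & σ & Hp).
  (* Several variables of [p] may read position 0 of the environment; all of them become the bound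
     variable. *)
  exists (fAll (rename (fun i => match σ i with inl 0 => 0 | _ => S i end) p)).
  exists (fun i => match σ i with inl (S j) => inl j | s => s end).
  intros ρ; cbn [sat].
  assert (H : forall x, Q ρ x <-> sat E p (look σ (scons x ρ))) by
    (intros x; apply (Hp (scons x ρ))).
  split; intros H' x; specialize (H' x); revert H'; rewrite H, sat_rename; apply sat_ext;
    intros i _; unfold look; destruct (σ i) as [[|j]|c] eqn:Ei; simpl; rewrite ?Ei; reflexivity.
Qed.

Lemma Df_rename (r : nat -> nat) P : Df P -> Df (fun ρ => P (fun n => ρ (r n))).
Proof.
  intros (p & σ & Hp); exists p.
  exists (fun i => match σ i with inl j => inl (r j) | s => s end).
  intros ρ; rewrite Hp; apply sat_ext; intros i _; unfold look; destruct (σ i); reflexivity.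
Qed.

Lemma Df_inst (Q : (nat -> N) -> N -> Prop) ρ :
  Df (fun ρ => Q (fun n => ρ (S n)) (ρ 0)) -> Df (fun ρ' => Q ρ (ρ' 0)).
Proof.
  intros (p & σ & Hp); exists p.
  exists (fun i => match σ i with inl 0 => inl 0 | inl (S j) => inr (ρ j) | s => s end).
  intros ρ'; specialize (Hp (scons (ρ' 0) ρ)); simpl in Hp; rewrite Hp.
  apply sat_ext; intros i _; unfold look; destruct (σ i) as [[|j]|c]; reflexivity.
Qed.

Lemma Df_not P : Df P -> Df (fun ρ => ~ P ρ).
Proof. intros H; apply Df_imp; [exact H|apply Df_const]. Qed.

Lemma Df_and P Q : Df P -> Df Q -> Df (fun ρ => P ρ /\ Q ρ).
Proof.
  intros HP HQ; apply Df_iff with (fun ρ => ~ (P ρ -> ~ Q ρ)); [intros; tauto|].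
  apply Df_not, Df_imp, Df_not; assumption.
Qed.

Lemma Df_or P Q : Df P -> Df Q -> Df (fun ρ => P ρ \/ Q ρ).
Proof.
  intros HP HQ; apply Df_iff with (fun ρ => ~ P ρ -> Q ρ); [intros; tauto|].
  apply Df_imp; [apply Df_not|]; assumption.
Qed.

Lemma Df_ex (Q : (nat -> N) -> N -> Prop) :
  Df (fun ρ => Q (fun n => ρ (S n)) (ρ 0)) -> Df (fun ρ => exists x, Q ρ x).
Proof.
  intros H; apply Df_iff with (fun ρ => ~ forall x, ~ Q ρ x).
  - intros ρ; split; [apply not_all_not_ex|intros [x Hx] H'; exact (H' x Hx)].
  - apply Df_not, Df_all, Df_not, H.
Qed.

Lemma Df_subst (Q : (nat -> N) -> N -> Prop) t :
  Tm t -> Df (fun ρ => Q (fun n => ρ (S n)) (ρ 0)) -> Df (fun ρ => Q ρ (t ρ)).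
Proof.
  intros Ht H; apply Df_iff with (fun ρ => exists x, x = t ρ /\ Q ρ x).
  - intros ρ; split; [intros (x & -> & Hx); exact Hx|eauto].
  - apply Df_ex, Df_and; assumption.
Qed.

Lemma Tm_weak t : Tm t -> Tm (fun ρ => t (fun n => ρ (S n))).
Proof.
  intros H.
  exact (Df_rename (fun n => match n with 0 => 0 | S n => S (S n) end) _ H).
Qed.

Lemma Tm_var i : Tm (fun ρ => ρ i).
Proof.
  exists (fEq 0 1), (fun n => match n with 0 => inl 0 | _ => inl (S i) end).
  intros ρ; reflexivity.
Qed.

Lemma Tm_const c : Tm (fun _ => c).
Proof.
  exists (fEq 0 1), (fun n => match n with 0 => inl 0 | _ => inr c end).
  intros ρ; reflexivity.
Qed.

Lemma Df_mem t u : Tm t -> Tm u -> Df (fun ρ => t ρ ∈ u ρ).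
Proof.
  intros Ht Hu; apply (Df_subst (fun ρ x => x ∈ u ρ)); auto.
  apply (Df_subst (fun ρ y => ρ 0 ∈ y) (fun ρ => u (fun n => ρ (S n)))).
  - apply Tm_weak, Hu.
  - exists (fMem 0 1), (fun n => match n with 0 => inl 1 | _ => inl 0 end).
    intros ρ; reflexivity.
Qed.

Lemma Df_eq t u : Tm t -> Tm u -> Df (fun ρ => t ρ = u ρ).
Proof.
  intros Ht Hu; apply (Df_subst (fun ρ x => x = u ρ)); auto.
Qed.

Definition Def1 (P : N -> Prop) : Prop := Df (fun ρ => P (ρ 0)).
Definition Def2 (R : N -> N -> Prop) : Prop := Df (fun ρ => R (ρ 0) (ρ 1)).
Definition DefF (F : N -> N) : Prop := Tm (fun ρ => F (ρ 0)).
Definition DefF2 (F : N -> N -> N) : Prop := Tm (fun ρ => F (ρ 0) (ρ 1)).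

Lemma Df_app1 P t : Def1 P -> Tm t -> Df (fun ρ => P (t ρ)).
Proof.
  intros H Ht; apply (Df_subst (fun ρ x => P x)); auto.
Qed.

Lemma Df_app2 R t u : Def2 R -> Tm t -> Tm u -> Df (fun ρ => R (t ρ) (u ρ)).
Proof.
  intros H Ht Hu; apply (Df_subst (fun ρ x => R x (u ρ))); auto.
  apply (Df_subst (fun ρ y => R (ρ 0) y) (fun ρ => u (fun n => ρ (S n)))).
  - apply Tm_weak, Hu.
  - exact (Df_rename (fun n => match n with 0 => 1 | _ => 0 end) _ H).
Qed.

Lemma Tm_app1 F t : DefF F -> Tm t -> Tm (fun ρ => F (t ρ)).
Proof.
  intros H Ht.
  apply (Df_subst (fun ρ x => ρ 0 = F x) (fun ρ => t (fun n => ρ (S n)))).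
  - apply Tm_weak, Ht.
  - exact (Df_rename (fun n => match n with 0 => 1 | _ => 0 end) _ H).
Qed.

Lemma Tm_app2 F t u : DefF2 F -> Tm t -> Tm u -> Tm (fun ρ => F (t ρ) (u ρ)).
Proof.
  intros H Ht Hu.
  apply (Df_subst (fun ρ x => ρ 0 = F x (u (fun n => ρ (S n)))) (fun ρ => t (fun n => ρ (S n)))).
  - apply Tm_weak, Ht.
  - apply (Df_subst (fun ρ y => ρ 1 = F (ρ 0) y) (fun ρ => u (fun n => ρ (S (S n))))).
    + apply (Tm_weak (fun ρ => u (fun n => ρ (S n)))), Tm_weak, Hu.
    + exact (Df_rename (fun n => match n with 0 => 2 | 1 => 1 | _ => 0 end) _ H).
Qed.

Definition the (P : N -> Prop) : N := epsilon (inhabits (rho0 0)) P.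

(** [epsilon] by itself is not definable. With existence and uniqueness its graph is [P], which
    is. *)
Lemma Tm_the (P : (nat -> N) -> N -> Prop) :
  (forall ρ, exists x, P ρ x) -> (forall ρ x y, P ρ x -> P ρ y -> x = y) ->
  Df (fun ρ => P (fun n => ρ (S n)) (ρ 0)) -> Tm (fun ρ => the (P ρ)).
Proof.
  intros He Hu; apply Df_iff; intros ρ.
  assert (H := epsilon_spec (inhabits (rho0 0)) _ (He (fun n => ρ (S n)))).
  split; [intros H'; eapply Hu; [exact H'|exact H]|intros ->; exact H].
Qed.

(** A hook of [df1], redefined whenever new definable operations become available. *)
Ltac df_ext := fail.

Ltac df1 := cbv beta;
  match goal with
  | |- Def1 _ => unfold Def1
  | |- Def2 _ => unfold Def2
  | |- DefF _ => unfold DefF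
  | |- DefF2 _ => unfold DefF2
  | |- Df (fun _ => ?P) => apply Df_const
  | |- Tm (fun ρ => ρ _) => apply Tm_var
  | |- Tm (fun _ => _) => apply Tm_const
  | H : Def2 ?R |- Df (fun ρ => ?R _ _) => apply (Df_app2 _ _ _ H)
  | H : Def1 ?R |- Df (fun ρ => ?R _) => apply (Df_app1 _ _ H)
  | H : DefF2 ?R |- Tm (fun ρ => ?R _ _) => apply (Tm_app2 _ _ _ H)
  | H : DefF ?R |- Tm (fun ρ => ?R _) => apply (Tm_app1 _ _ H)
  | |- Df (fun ρ => _ ∈ _) => apply Df_mem
  | |- Df (fun ρ => _ = _) => apply Df_eq
  | |- Df (fun ρ => _ /\ _) => apply Df_and
  | |- Df (fun ρ => _ \/ _) => apply Df_or
  | |- Df (fun ρ => _ <-> _) => apply Df_and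
  | |- Df (fun ρ => ~ _) => apply Df_not
  | |- Df (fun ρ => exists x, _) => apply Df_ex
  | |- Df (fun ρ => forall x : N, _) => apply Df_all
  | |- Df (fun ρ => _ -> _) => apply Df_imp
  | _ => df_ext
  | |- Df _ => first [apply Df_all | apply Df_ex | apply Df_and | apply Df_or
                     | apply Df_imp | apply Df_mem | apply Df_eq]
  end.
Ltac df := repeat df1.

(** ** The axioms of ZFC *)

Lemma sat_and p q ρ A B : (sat E p ρ <-> A) -> (sat E q ρ <-> B) ->
  (sat E (fImp (fImp p (fImp q fBot)) fBot) ρ <-> A /\ B).
Proof. simpl; tauto. Qed.
Lemma sat_or p q ρ A B : (sat E p ρ <-> A) -> (sat E q ρ <-> B) ->
  (sat E (fImp (fImp p fBot) q) ρ <-> A \/ B).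
Proof. simpl; tauto. Qed.
Lemma sat_not p ρ A : (sat E p ρ <-> A) -> (sat E (fImp p fBot) ρ <-> ~ A).
Proof. simpl; tauto. Qed.
Lemma sat_imp p q ρ A B : (sat E p ρ <-> A) -> (sat E q ρ <-> B) ->
  (sat E (fImp p q) ρ <-> (A -> B)).
Proof. simpl; tauto. Qed.
Lemma sat_all p ρ (A : N -> Prop) : (forall x, sat E p (scons x ρ) <-> A x) ->
  (sat E (fAll p) ρ <-> forall x, A x).
Proof. simpl; intros H; split; intros H' x; apply H, H'. Qed.
Lemma sat_ex p ρ (A : N -> Prop) : (forall x, sat E p (scons x ρ) <-> A x) ->
  (sat E (fImp (fAll (fImp p fBot)) fBot) ρ <-> exists x, A x).
Proof.
  simpl; intros H; split.
  - intros H'; apply NNPP; intros Hn; apply H'; intros a Ha; apply Hn; exists a; apply H, Ha.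
  - intros [x Hx] H'; apply (H' x), H, Hx.
Qed.

Lemma iff_elim (A B : Prop) : (A <-> B) -> A -> B.
Proof. tauto. Qed.

Ltac head t := match t with ?f _ => head f | _ => t end.
Ltac sem1 :=
  match goal with
  | |- sat _ _ _ <-> (_ /\ _) => apply sat_and
  | |- sat _ _ _ <-> (_ <-> _) => apply sat_and
  | |- sat _ _ _ <-> (_ \/ _) => apply sat_or
  | |- sat _ _ _ <-> ~ _ => apply sat_not
  | |- sat _ _ _ <-> (exists x, _) => apply sat_ex; intro
  | |- sat _ _ _ <-> (forall x : N, _) => apply sat_all; intro
  | |- sat _ _ _ <-> (_ -> _) => apply sat_imp
  | |- sat _ (fMem _ _) _ <-> _ => reflexivity
  | |- sat _ (fEq _ _) _ <-> _ => reflexivity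
  | |- _ <-> ?t => let h := head t in unfold h
  end.
(** The formula is first computed to plain de Bruijn form; then the shape of the proposition on the
    right decides which connective to read off, and its head is unfolded when it is a defined
    notion. *)
Ltac sem :=
  match goal with |- sat E ?p ?r <-> _ =>
    let q := eval vm_compute in p in change p with q end; repeat sem1.

(** These notions repeat the formulas [bEmpty], [bSub] and so on connective by connective, since
    [sem] matches the two sides by shape. *)
Definition isEmpty x := forall z, ~ z ∈ x.
Definition Sub x y := forall z, z ∈ x -> z ∈ y.
Definition isUpair p x y := forall z, z ∈ p <-> z = x \/ z = y.
Definition isOpair p x y := exists s t, isUpair s x x /\ isUpair t x y /\ isUpair p s t.
Definition PairIn x y f := exists p, isOpair p x y /\ p ∈ f.
Definition isUniq (p : N -> Prop) := exists y, p y /\ forall z, p z -> z = y.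
Definition isFun f a b :=
  (forall p, p ∈ f -> exists x y, x ∈ a /\ y ∈ b /\ isOpair p x y) /\
  (forall x, x ∈ a -> isUniq (fun y => PairIn x y f)).
Definition isBij f a b := isFun f a b /\ (forall y, y ∈ b -> isUniq (fun x => PairIn x y f)).
Definition isSucc s x := forall z, z ∈ s <-> z ∈ x \/ z = x.
Definition isInductive w :=
  (exists e, isEmpty e /\ e ∈ w) /\ (forall x, x ∈ w -> exists s, isSucc s x /\ s ∈ w).
Definition Ord a := (forall x, x ∈ a -> Sub x a) /\
  (forall x y, x ∈ a -> y ∈ a -> x ∈ y \/ x = y \/ y ∈ x).
Definition Card k := Ord k /\ forall a, a ∈ k -> ~ exists f, isBij f a k.
Definition CardLt x k := exists a, a ∈ k /\ exists f, isBij f x a.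

Lemma ext x y : (forall z, z ∈ x <-> z ∈ y) -> x = y.
Proof.
  cut (forall x y, (forall z, z ∈ x <-> z ∈ y) -> x = y); [eauto|].
  refine (iff_elim _ _ _ (zfc_true _ ZFC_ext)); sem.
Qed.

Lemma foundation x : ~ isEmpty x -> exists y, y ∈ x /\ forall z, z ∈ x -> ~ z ∈ y.
Proof.
  revert x; refine (iff_elim _ _ _ (zfc_true _ ZFC_found)); sem.
Qed.

Lemma ax_pair_sem x y : exists p, isUpair p x y.
Proof. revert x y; refine (iff_elim _ _ _ (zfc_true _ ZFC_pair)); sem. Qed.

Lemma ax_union_sem x : exists u, forall z, z ∈ u <-> exists y, y ∈ x /\ z ∈ y.
Proof. revert x; refine (iff_elim _ _ _ (zfc_true _ ZFC_union)); sem. Qed.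

Lemma ax_power_sem x : exists p, forall y, y ∈ p <-> Sub y x.
Proof. revert x; refine (iff_elim _ _ _ (zfc_true _ ZFC_power)); sem. Qed.

Lemma ax_choice_sem F : (forall x, x ∈ F -> ~ isEmpty x) ->
  exists f b, isFun f F b /\ forall x y, x ∈ F -> PairIn x y f -> y ∈ x.
Proof. revert F; refine (iff_elim _ _ _ (zfc_true _ ZFC_choice)); sem. Qed.

Definition prefix (n : nat) (σ ρ : nat -> N) : nat -> N :=
  fun i => if i <? n then σ i else ρ (i - n).

Lemma sat_closure n p ρ :
  sat E (Nat.iter n fAll p) ρ -> forall σ, sat E p (prefix n σ ρ).
Proof.
  revert ρ; induction n as [|n IH]; intros ρ H σ.
  - revert H; apply sat_ext; intros x _; unfold prefix; simpl; f_equal; lia.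
  - specialize (IH _ (H (σ n)) σ); revert IH; apply sat_ext; intros x _; unfold prefix.
    destruct (Nat.ltb_spec x n), (Nat.ltb_spec x (S n)); try lia; auto.
    + replace x with n by lia; rewrite Nat.sub_diag; reflexivity.
    + replace (x - n) with (S (x - S n)) by lia; reflexivity.
Qed.

Lemma bounded_mono p : forall n m, n <= m -> bounded n p -> bounded m p.
Proof.
  induction p as [|a b|a b|p IHp q IHq|p IHp]; simpl; intros n m L; try lia.
  - intros [? ?]; eauto.
  - apply IHp; lia.
Qed.

Lemma bounded_exists p : exists n, bounded n p.
Proof.
  induction p as [|a b|a b|p [n Hn] q [m Hm]|p [n Hn]]; simpl.
  - exists 0; auto.
  - exists (S (a + b)); lia.
  - exists (S (a + b)); lia.
  - exists (n + m); split; [apply bounded_mono with n|apply bounded_mono with m]; auto; lia.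
  - exists n; apply bounded_mono with n; auto.
Qed.

Lemma bounded_free p : forall n x, bounded n p -> free x p -> x < n.
Proof.
  induction p as [|a b|a b|p IHp q IHq|p IHp]; simpl; intros n x; try lia.
  - intros [? ?] [?|?]; eauto.
  - intros H H'; apply (IHp _ _ H) in H'; lia.
Qed.

Ltac idx_simpl n := unfold bMem, idx; cbn [sat]; rewrite ?Nat.sub_diag;
  replace (S (S (S n)) - S n) with 2 by lia;
  replace (S (S (S n)) - S (S n)) with 1 by lia; reflexivity.

Lemma ax_sep_sem p σ a : exists b, forall x, x ∈ b <-> x ∈ a /\ sat E p (scons x σ).
Proof.
  destruct (bounded_exists p) as [n Hn].
  apply (bounded_mono p n (1 + n)) in Hn; [|lia].
  pose proof (sat_closure _ _ _ (zfc_true _ (ZFC_sep n p Hn)) σ) as H.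
  revert a; refine (iff_elim _ _ _ H).
  apply sat_all; intros a; apply sat_ex; intros b; apply sat_all; intros x.
  (* Below the [n] binders of the closure, the variables [a], [b], [x] of the axiom have levels [n],
     [n + 1], [n + 2]. *)
  assert (Hp : sat E (app n p [n + 2] (3 + n)) (scons x (scons b (scons a (prefix n σ rho0))))
    <-> sat E p (scons x σ)).
  { unfold app; rewrite sat_rename; apply sat_ext; intros i Hi.
    apply (bounded_free _ _ _ Hn) in Hi; destruct i as [|i]; simpl length.
    - simpl; unfold idx; replace (S (S (S n)) - S (n + 2)) with 0 by lia; reflexivity.
    - destruct (Nat.ltb_spec (S i) 1); [lia|].
      replace (S i - 1 + (3 + n - n)) with (S (S (S i))) by lia; simpl; unfold prefix.
      destruct (Nat.ltb_spec i n); [reflexivity|lia]. }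
  replace (n + 2) with (S (S n)) in Hp by lia.
  apply sat_and; apply sat_imp; try (apply sat_and; [|exact Hp]); idx_simpl n.
Qed.

Lemma ax_repl_sem p σ a :
  (forall x y z, x ∈ a -> sat E p (scons x (scons y σ)) -> sat E p (scons x (scons z σ)) -> y = z) ->
  exists b, forall y, y ∈ b <-> exists x, x ∈ a /\ sat E p (scons x (scons y σ)).
Proof.
  destruct (bounded_exists p) as [n Hn].
  apply (bounded_mono p n (2 + n)) in Hn; [|lia].
  pose proof (sat_closure _ _ _ (zfc_true _ (ZFC_repl n p Hn)) σ) as H.
  revert a; refine (iff_elim _ _ _ H).
  (* Every occurrence of [p] in the axiom lies below four binders inside the closure ([a x y z] or
     [a b y x]): [u] is that number, [τ] the part of the environment beyond them, and [v 0], [v 1]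
     are the values of the two displayed variables. *)
  assert (Hp : forall d x y ρ τ u v, d = n + u -> ρ (idx d x) = v 0 -> ρ (idx d y) = v 1 ->
    (forall i, ρ (u + i) = τ i) ->
    (forall i, i < n -> τ i = σ i) ->
    sat E (app n p [x; y] d) ρ
    <-> sat E p (scons (v 0) (scons (v 1) σ))).
  { intros d x y ρ τ u v -> H0 H1 Et Es.
    unfold app; rewrite sat_rename; apply sat_ext; intros i Hi.
    apply (bounded_free _ _ _ Hn) in Hi; destruct i as [|[|i]]; simpl length.
    - exact H0.
    - exact H1.
    - destruct (Nat.ltb_spec (S (S i)) 2); [lia|].
      replace (S (S i) - 2 + (n + u - n)) with (u + i) by lia.
      rewrite Et, Es; [reflexivity|lia]. }
  assert (Hσ : forall i, i < n -> prefix n σ rho0 i = σ i).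
  { intros i Hi; unfold prefix; destruct (Nat.ltb_spec i n); [reflexivity|lia]. }
  apply sat_all; intros a; apply sat_imp.
  - apply sat_all; intros x; apply sat_all; intros y; apply sat_all; intros z.
    apply sat_imp; [|apply sat_imp; [|apply sat_imp]].
    + unfold bMem, idx; cbn [sat]; replace (S (S (S (S n))) - S n) with 3 by lia;
      replace (S (S (S (S n))) - S (S n)) with 2 by lia; reflexivity.
    + apply (Hp _ _ _ _ (prefix n σ rho0) 4 (scons x (fun _ => y))); auto; try lia; unfold idx.
      * replace (S (S (S (S n))) - S (S n)) with 2 by lia; reflexivity.
      * replace (S (S (S (S n))) - S (S (S n))) with 1 by lia; reflexivity.
    + apply (Hp _ _ _ _ (prefix n σ rho0) 4 (scons x (fun _ => z))); auto; try lia; unfold idx.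
      * replace (S (S (S (S n))) - S (S n)) with 2 by lia; reflexivity.
      * rewrite Nat.sub_diag; reflexivity.
    + unfold bEq, idx; cbn [sat]; rewrite Nat.sub_diag;
      replace (S (S (S (S n))) - S (S (S n))) with 1 by lia; reflexivity.
  - apply sat_ex; intros b; apply sat_all; intros y.
    apply sat_and; apply sat_imp; try (apply sat_ex; intros x; apply sat_and);
      try (apply (Hp _ _ _ _ (prefix n σ rho0) 4 (scons x (fun _ => y))); auto; try lia);
      unfold bMem, idx; cbn [sat]; rewrite ?Nat.sub_diag;
      replace (S (S (S n)) - S (S n)) with 1 by lia;
      replace (S (S (S (S n))) - S (S (S n))) with 1 by lia;
      replace (S (S (S (S n))) - S n) with 3 by lia; reflexivity.
Qed.

(** ** Basic set operations *)

Lemma the_spec (P : N -> Prop) : (exists x, P x) -> P (the P).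
Proof. apply epsilon_spec. Qed.

(** [P] depends on position 0 only, so the environment may be taken constant and all variables read
    off it identified. *)
Lemma separation (a : N) (P : N -> Prop) :
  Def1 P -> exists b, forall x, x ∈ b <-> x ∈ a /\ P x.
Proof.
  intros (p & σ & Hp).
  destruct (ax_sep_sem (rename (fun i => match σ i with inl _ => 0 | _ => S i end) p)
    (fun i => match σ i with inl _ => a | inr c => c end) a) as [b Hb].
  exists b; intros x; rewrite Hb, sat_rename, (Hp (fun _ => x)).
  apply and_iff_compat_l, sat_ext; intros i _; unfold look.
  destruct (σ i) eqn:Ei; simpl; rewrite ?Ei; reflexivity.
Qed.

Lemma replacement (a : N) (F : N -> N) :
  DefF F -> exists b, forall y, y ∈ b <-> exists x, x ∈ a /\ y = F x.
Proof.
  intros (p & σ & Hp).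
  set (p' := rename (fun i => match σ i with inl 0 => 1 | inl _ => 0 | _ => S (S i) end) p).
  set (σ' := fun i => match σ i with inl _ => a | inr c => c end).
  assert (H : forall x y, sat E p' (scons x (scons y σ')) <-> y = F x).
  { intros x y; unfold p'; rewrite sat_rename.
    rewrite (Hp (scons y (fun _ => x))).
    apply sat_ext; intros i _; unfold look, σ'.
    destruct (σ i) as [[|j]|c] eqn:Ei; simpl; rewrite ?Ei; reflexivity. }
  destruct (ax_repl_sem p' σ' a) as [b Hb].
  - intros x y z _; rewrite !H; congruence.
  - exists b; intros y; rewrite Hb; split; intros (x & Hx & Hy); exists x; split; auto;
      apply H, Hy.
Qed.

Definition empty : N := the isEmpty.
Definition upr a b : N := the (fun p => isUpair p a b).
Definition Un a : N := the (fun u => forall z, z ∈ u <-> exists y, y ∈ a /\ z ∈ y).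
Definition pow a : N := the (fun p => forall y, y ∈ p <-> Sub y a).
(** The operator accepts every [P], but its value is specified only if the subset exists; hence the
    definability premise of [in_sep]. The same holds for [im]. *)
Definition sep a (P : N -> Prop) : N := the (fun b => forall x, x ∈ b <-> x ∈ a /\ P x).
Definition im a (F : N -> N) : N :=
  the (fun b => forall y, y ∈ b <-> exists x, x ∈ a /\ y = F x).

Lemma in_sep P a x : Def1 P -> (x ∈ sep a P <-> x ∈ a /\ P x).
Proof.
  intros HP; revert x.
  apply (the_spec (fun b => forall x, x ∈ b <-> x ∈ a /\ P x)), separation, HP.
Qed.

Lemma in_im F a y : DefF F -> (y ∈ im a F <-> exists x, x ∈ a /\ y = F x).
Proof.
  intros HF; revert y.
  apply (the_spec (fun b => forall y, y ∈ b <-> exists x, x ∈ a /\ y = F x)), replacement, HF.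
Qed.

Lemma im_intro F a x : DefF F -> x ∈ a -> F x ∈ im a F.
Proof. intros HF Hx; apply in_im; eauto. Qed.

Lemma in_upr a b x : x ∈ upr a b <-> x = a \/ x = b.
Proof. revert x; apply (the_spec (fun p => isUpair p a b)), ax_pair_sem. Qed.

Lemma in_Un a x : x ∈ Un a <-> exists y, y ∈ a /\ x ∈ y.
Proof.
  revert x.
  apply (the_spec (fun u => forall z, z ∈ u <-> exists y, y ∈ a /\ z ∈ y)), ax_union_sem.
Qed.

Lemma in_pow a x : x ∈ pow a <-> Sub x a.
Proof. revert x; apply (the_spec (fun p => forall y, y ∈ p <-> Sub y a)), ax_power_sem. Qed.

Lemma in_empty x : ~ x ∈ empty.
Proof.
  revert x; apply (the_spec isEmpty).
  destruct (separation (rho0 0) (fun _ => False)) as [b Hb]; [df|].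
  exists b; intros x Hx; apply Hb in Hx; tauto.
Qed.

Lemma not_empty a : a <> empty -> exists x, x ∈ a.
Proof.
  intros H; apply NNPP; intros H'; apply H, ext; intros z; split; intros Hz.
  - exfalso; eauto.
  - destruct (in_empty _ Hz).
Qed.

Lemma Tm_upr t u : Tm t -> Tm u -> Tm (fun ρ => upr (t ρ) (u ρ)).
Proof.
  intros Ht Hu; apply (Tm_app2 upr); auto.
  apply (Tm_the (fun ρ p => isUpair p (ρ 0) (ρ 1))).
  - intros ρ; apply ax_pair_sem.
  - intros ρ x y Hx Hy; apply ext; intros z; rewrite (Hx z), (Hy z); tauto.
  - df.
Qed.

Lemma Tm_Un t : Tm t -> Tm (fun ρ => Un (t ρ)).
Proof.
  intros Ht; apply (Tm_app1 Un); auto.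
  apply (Tm_the (fun ρ u => forall z, z ∈ u <-> exists y, y ∈ ρ 0 /\ z ∈ y)).
  - intros ρ; apply ax_union_sem.
  - intros ρ x y Hx Hy; apply ext; intros z; rewrite (Hx z), (Hy z); tauto.
  - df.
Qed.

Lemma Tm_pow t : Tm t -> Tm (fun ρ => pow (t ρ)).
Proof.
  intros Ht; apply (Tm_app1 pow); auto.
  apply (Tm_the (fun ρ p => forall y, y ∈ p <-> Sub y (ρ 0))).
  - intros ρ; apply ax_power_sem.
  - intros ρ x y Hx Hy; apply ext; intros z; rewrite (Hx z), (Hy z); tauto.
  - df.
Qed.

Lemma Tm_sep t (P : (nat -> N) -> N -> Prop) :
  Tm t -> Df (fun ρ => P (fun n => ρ (S n)) (ρ 0)) -> Tm (fun ρ => sep (t ρ) (P ρ)).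
Proof.
  intros Ht HP.
  apply (Tm_the (fun ρ b => forall x, x ∈ b <-> x ∈ t ρ /\ P ρ x)).
  - intros ρ; apply separation, (Df_inst P ρ), HP.
  - intros ρ x y Hx Hy; apply ext; intros z; rewrite (Hx z), (Hy z); tauto.
  - apply Df_all, Df_and; apply Df_imp; try apply Df_and; df.
    all: try apply (Tm_weak (fun ρ => t (fun n => ρ (S n)))), Tm_weak, Ht.
    all: exact (Df_rename (fun n => match n with 0 => 0 | S n => S (S n) end) _ HP).
Qed.

Lemma Tm_im t (F : (nat -> N) -> N -> N) :
  Tm t -> Tm (fun ρ => F (fun n => ρ (S n)) (ρ 0)) -> Tm (fun ρ => im (t ρ) (F ρ)).
Proof.
  intros Ht HF.
  apply (Tm_the (fun ρ b => forall y, y ∈ b <-> exists x, x ∈ t ρ /\ y = F ρ x)).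
  - intros ρ; apply replacement.
    unfold DefF, Tm.
    destruct HF as (p & σ & Hp); exists p.
    exists (fun i => match σ i with inl 0 => inl 0 | inl 1 => inl 1
                     | inl (S (S j)) => inr (ρ j) | s => s end).
    intros ρ'; specialize (Hp (scons (ρ' 0) (scons (ρ' 1) ρ))); simpl in Hp; rewrite Hp.
    apply sat_ext; intros i _; unfold look; destruct (σ i) as [[|[|j]]|c]; reflexivity.
  - intros ρ x y Hx Hy; apply ext; intros z; rewrite (Hx z), (Hy z); tauto.
  - apply Df_all, Df_and; apply Df_imp; try apply Df_ex, Df_and; df.
    all: try exact (Tm_weak _ (Tm_weak _ (Tm_weak _ Ht))).
    all: exact (Df_rename (fun n => match n with 0 => 0 | 1 => 1 | S (S n) => S (S (S (S n))) end) _ HF).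
Qed.

Ltac df_ext ::=
  match goal with
  | |- Tm (fun ρ => sep _ _) => apply Tm_sep
  | |- Tm (fun ρ => im _ _) => apply Tm_im
  | |- Tm (fun ρ => upr _ _) => apply Tm_upr
  | |- Tm (fun ρ => Un _) => apply Tm_Un
  | |- Tm (fun ρ => pow _) => apply Tm_pow
  | |- Tm _ => first [apply Tm_sep | apply Tm_im | apply Tm_upr | apply Tm_Un]
  end.

(** * Pairs, products and functions *)

Definition cup a b := Un (upr a b).
Definition cap a b := sep a (fun x => x ∈ b).
Definition pr a b := upr (upr a a) (upr a b).
Definition prod a b := sep (pow (pow (cup a b))) (fun p => exists x y, x ∈ a /\ y ∈ b /\ p = pr x y).
Definition lam a (F : N -> N) := im a (fun x => pr x (F x)).
(** The union of all [y] with [pr x y ∈ f] is the value when that [y] is unique, and makes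
    application total. Components of pairs in [f] are found in its double union. *)
Definition ap f x := Un (sep (Un (Un f)) (fun y => pr x y ∈ f)).

Lemma in_cup a b x : x ∈ cup a b <-> x ∈ a \/ x ∈ b.
Proof.
  unfold cup; rewrite in_Un; split.
  - intros (y & Hy & Hx); apply in_upr in Hy as [->| ->]; auto.
  - intros [H|H]; [exists a|exists b]; rewrite in_upr; auto.
Qed.

Lemma in_cap a b x : x ∈ cap a b <-> x ∈ a /\ x ∈ b.
Proof. apply (in_sep (fun x => x ∈ b)); df. Qed.

Lemma upr_inj a b c d : upr a b = upr c d -> (a = c /\ b = d) \/ (a = d /\ b = c).
Proof.
  intros H.
  assert (a ∈ upr c d) by (rewrite <- H, in_upr; auto).
  assert (b ∈ upr c d) by (rewrite <- H, in_upr; auto).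
  assert (c ∈ upr a b) by (rewrite H, in_upr; auto).
  assert (d ∈ upr a b) by (rewrite H, in_upr; auto).
  rewrite in_upr in *; intuition congruence.
Qed.

Lemma pr_inj a b c d : pr a b = pr c d -> a = c /\ b = d.
Proof.
  intros H; apply upr_inj in H as [[H H']|[H H']];
    apply upr_inj in H, H'; intuition congruence.
Qed.

Lemma isUpair_iff p a b : isUpair p a b <-> p = upr a b.
Proof.
  split.
  - intros H; apply ext; intros z; rewrite in_upr; apply H.
  - intros -> z; apply in_upr.
Qed.

Lemma isOpair_iff p a b : isOpair p a b <-> p = pr a b.
Proof.
  unfold isOpair, pr; split.
  - intros (s & t & Hs & Ht & Hp); rewrite isUpair_iff in *; congruence.
  - intros ->; exists (upr a a), (upr a b); rewrite !isUpair_iff; auto.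
Qed.

Lemma PairIn_iff x y f : PairIn x y f <-> pr x y ∈ f.
Proof.
  unfold PairIn; split.
  - intros (p & Hp & H); apply isOpair_iff in Hp; congruence.
  - intros H; exists (pr x y); rewrite isOpair_iff; auto.
Qed.

Lemma in_prod a b x y : pr x y ∈ prod a b <-> x ∈ a /\ y ∈ b.
Proof.
  unfold prod; rewrite in_sep by df; split.
  - intros [_ (u & v & Hu & Hv & H)]; apply pr_inj in H as [-> ->]; auto.
  - intros [Hx Hy]; split; [|eauto 6].
    apply in_pow; intros z Hz; apply in_upr in Hz as [->| ->]; apply in_pow;
      intros w Hw; apply in_upr in Hw; apply in_cup; intuition congruence.
Qed.

Lemma in_prod_ex a b p : p ∈ prod a b -> exists x y, x ∈ a /\ y ∈ b /\ p = pr x y.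
Proof. unfold prod; rewrite in_sep by df; tauto. Qed.

Lemma ap_eq f x y : pr x y ∈ f -> (forall z, pr x z ∈ f -> z = y) -> ap f x = y.
Proof.
  intros H Hu; apply ext; intros w; unfold ap; rewrite in_Un; split.
  - intros (z & Hz & Hw); rewrite in_sep in Hz by df; destruct Hz as [_ Hz].
    apply Hu in Hz; congruence.
  - intros Hw; exists y; split; auto; rewrite in_sep by df; split; auto.
    apply in_Un; exists (upr x y); rewrite in_upr; split; auto.
    apply in_Un; exists (pr x y); split; auto; apply in_upr; auto.
Qed.

Lemma ap_lam a F x : DefF F -> x ∈ a -> ap (lam a F) x = F x.
Proof.
  intros HF Hx; assert (DefF (fun x => pr x (F x))) by (unfold pr; df).
  apply ap_eq; unfold lam; rewrite ?in_im by auto; eauto.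
  intros z Hz; rewrite in_im in Hz by auto; destruct Hz as (w & _ & Hw).
  apply pr_inj in Hw as [-> ->]; auto.
Qed.

Lemma lam_pr a F x y : DefF F -> (pr x y ∈ lam a F <-> x ∈ a /\ y = F x).
Proof.
  intros HF; assert (DefF (fun x => pr x (F x))) by (unfold pr; df).
  unfold lam; rewrite in_im by auto; split.
  - intros (w & Hw & He); apply pr_inj in He as [-> ->]; auto.
  - intros [Hx ->]; eauto.
Qed.

Lemma isFun_lam a b F : DefF F -> (forall x, x ∈ a -> F x ∈ b) -> isFun (lam a F) a b.
Proof.
  intros HF Hb; assert (DefF (fun x => pr x (F x))) by (unfold pr; df). split.
  - intros p Hp; unfold lam in Hp; rewrite in_im in Hp by auto; destruct Hp as (x & Hx & ->).
    exists x, (F x); rewrite isOpair_iff; auto.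
  - intros x Hx; exists (F x); rewrite PairIn_iff, lam_pr by auto; split; auto.
    intros z; rewrite PairIn_iff, lam_pr by auto; tauto.
Qed.

Lemma isFun_ap f a b x : isFun f a b -> x ∈ a -> pr x (ap f x) ∈ f /\ ap f x ∈ b.
Proof.
  intros [H1 H2] Hx; destruct (H2 x Hx) as (y & Hy & Hu); rewrite PairIn_iff in Hy.
  rewrite (ap_eq f x y); auto.
  - split; auto; destruct (H1 _ Hy) as (u & v & Hu' & Hv & Hp).
    apply isOpair_iff, pr_inj in Hp as [_ ->]; auto.
  - intros z Hz; apply Hu, PairIn_iff, Hz.
Qed.

Lemma isFun_pr f a b x y : isFun f a b -> (pr x y ∈ f <-> x ∈ a /\ y = ap f x).
Proof.
  intros Hf; split.
  - intros H; destruct (proj1 Hf _ H) as (u & v & Hu & _ & Hp).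
    apply isOpair_iff, pr_inj in Hp as [<- _]; split; auto.
    destruct (proj2 Hf x Hu) as (w & Hw & Hw').
    rewrite (Hw' y), (Hw' (ap f x)); auto; apply PairIn_iff; auto.
    apply (isFun_ap f a b); auto.
  - intros [Hx ->]; apply (isFun_ap f a b); auto.
Qed.

(** ** Ordinals *)

Lemma mem_irrefl x : ~ x ∈ x.
Proof.
  intros H; destruct (foundation (upr x x)) as (y & Hy & Hz).
  - intros He; apply (He x), in_upr; auto.
  - apply in_upr in Hy; assert (y = x) as -> by tauto; apply (Hz x); auto; apply in_upr; auto.
Qed.

Lemma mem_asym x y : x ∈ y -> ~ y ∈ x.
Proof.
  intros H H'; destruct (foundation (upr x y)) as (z & Hz & Hw).
  - intros He; apply (He x), in_upr; auto.
  - apply in_upr in Hz as [->| ->]; [apply (Hw y)|apply (Hw x)]; auto; apply in_upr; auto.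
Qed.

Lemma mem_acyclic x y z : x ∈ y -> y ∈ z -> ~ z ∈ x.
Proof.
  intros H H' H''; destruct (foundation (cup (upr x y) (upr z z))) as (w & Hw & Hv).
  - intros He; apply (He x), in_cup; rewrite in_upr; auto.
  - rewrite in_cup, !in_upr in Hw; destruct Hw as [[->| ->]|[->| ->]];
      [apply (Hv z)|apply (Hv x)|apply (Hv y)|apply (Hv y)]; auto;
      rewrite in_cup, !in_upr; auto.
Qed.

Lemma Ord_trans L a b c : Ord L -> c ∈ L -> a ∈ b -> b ∈ c -> a ∈ c.
Proof.
  intros [H1 H2] Hc Hab Hbc.
  assert (b ∈ L) by (apply (H1 c); auto). assert (a ∈ L) by (apply (H1 b); auto).
  destruct (H2 a c) as [?|[->|?]]; auto.
  - destruct (mem_asym _ _ Hab Hbc).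
  - destruct (mem_acyclic _ _ _ Hab Hbc H3).
Qed.

Lemma Ord_elem L a : Ord L -> a ∈ L -> Ord a.
Proof.
  intros HL Ha; split.
  - intros x Hx y Hy; apply (Ord_trans L) with x; auto.
  - intros x y Hx Hy; apply (proj2 HL); apply (proj1 HL a); auto.
Qed.

Lemma Ord_least L (P : N -> Prop) x : Ord L -> Def1 P -> x ∈ L -> P x ->
  exists y, y ∈ L /\ P y /\ forall z, z ∈ L -> P z -> ~ z ∈ y.
Proof.
  intros HL HP Hx Px; destruct (foundation (sep L P)) as (y & Hy & Hz).
  - intros He; apply (He x); rewrite in_sep; auto.
  - rewrite in_sep in Hy by auto; destruct Hy as [Hy Py].
    exists y; split; [|split]; auto; intros z Hz1 Hz2; apply Hz; rewrite in_sep; auto.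
Qed.

Lemma Ord_ind L (P : N -> Prop) : Ord L -> Def1 P ->
  (forall x, x ∈ L -> (forall y, y ∈ x -> P y) -> P x) -> forall x, x ∈ L -> P x.
Proof.
  intros HL HP H x Hx; apply NNPP; intros Hn.
  destruct (Ord_least L (fun x => ~ P x) x) as (y & Hy & Py & Hz); auto; [df|].
  apply Py, H; auto; intros z Hz'; apply NNPP; intros Hn'.
  apply (Hz z); auto; apply (proj1 HL y); auto.
Qed.

(* [⋃ {y}] turns the least witness into a definable term that is total. *)
Definition least L (P : N -> Prop) :=
  Un (sep L (fun x => P x /\ forall z, z ∈ L -> P z -> ~ z ∈ x)).

Lemma least_spec L P x : Ord L -> Def1 P -> x ∈ L -> P x ->
  least L P ∈ L /\ P (least L P) /\ forall z, z ∈ L -> P z -> ~ z ∈ least L P.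
Proof.
  intros HL HP Hx Px; destruct (Ord_least L P x) as (y & Hy & Py & Hm); auto.
  replace (least L P) with y; auto.
  apply ext; intros w; unfold least; rewrite in_Un; split.
  - intros Hw; exists y; rewrite in_sep by df; auto.
  - intros (z & Hz & Hw); rewrite in_sep in Hz by df; destruct Hz as (Hz & Pz & Hz').
    replace y with z; auto; destruct (proj2 HL z y) as [H|[H|H]]; auto;
      [destruct (Hm z)|destruct (Hz' y)]; auto.
Qed.

Lemma DefF2_cup : DefF2 cup.
Proof. unfold cup; df. Qed.
Lemma DefF2_cap : DefF2 cap.
Proof. unfold cap; df. Qed.
Lemma DefF2_pr : DefF2 pr.
Proof. unfold pr; df. Qed.
Lemma DefF2_ap : DefF2 ap.
Proof. unfold ap; df; apply (Tm_app2 _ _ _ DefF2_pr); df. Qed.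

(* The unique witness of [P], or [∅] if there is none. *)
Definition iota (P : N -> Prop) : N :=
  the (fun v => (isUniq P /\ P v) \/ (~ isUniq P /\ v = empty)).

Lemma iota_eq P v : P v -> (forall z, P z -> z = v) -> iota P = v.
Proof.
  intros Hv Hu; assert (H : isUniq P) by (exists v; auto).
  destruct (the_spec (fun v => (isUniq P /\ P v) \/ (~ isUniq P /\ v = empty))) as [H'|H'];
    [exists v; auto|apply Hu, H'|tauto].
Qed.

Lemma iota_spec P : isUniq P -> P (iota P).
Proof. intros (v & Hv & Hu); rewrite (iota_eq P v); auto. Qed.

Lemma Tm_iota (P : (nat -> N) -> N -> Prop) :
  Df (fun ρ => P (fun n => ρ (S n)) (ρ 0)) -> Tm (fun ρ => iota (P ρ)).
Proof.
  intros HP; apply (Tm_the (fun ρ v => (isUniq (P ρ) /\ P ρ v) \/ (~ isUniq (P ρ) /\ v = empty))).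
  - intros ρ; destruct (classic (isUniq (P ρ))) as [H|H]; [|exists empty; auto].
    assert (H' := H); destruct H' as (v & Hv & _); exists v; auto.
  - intros ρ x y [[H Hx]|[H ->]] [[H' Hy]|[H' ->]]; try tauto.
    destruct H as (v & _ & Hu); rewrite (Hu x), (Hu y); auto.
  - assert (HU : Df (fun ρ => isUniq (P (fun n => ρ (S n))))).
    { unfold isUniq; apply Df_ex, Df_and; [|apply Df_all, Df_imp; [|df]].
      - exact (Df_rename (fun n => match n with 0 => 0 | S n => S (S n) end) _ HP).
      - exact (Df_rename (fun n => match n with 0 => 0 | S n => S (S (S n)) end) _ HP). }
    apply Df_or; apply Df_and; auto; [apply Df_not; auto|df].
Qed.

Ltac df_ext ::=
  match goal with
  | |- Tm (fun ρ => sep _ _) => apply Tm_sep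
  | |- Tm (fun ρ => im _ _) => apply Tm_im
  | |- Tm (fun ρ => upr _ _) => apply Tm_upr
  | |- Tm (fun ρ => Un _) => apply Tm_Un
  | |- Tm (fun ρ => pow _) => apply Tm_pow
  | |- Tm (fun ρ => pr _ _) => apply (Tm_app2 _ _ _ DefF2_pr)
  | |- Tm (fun ρ => ap _ _) => apply (Tm_app2 _ _ _ DefF2_ap)
  | |- Tm (fun ρ => cup _ _) => apply (Tm_app2 _ _ _ DefF2_cup)
  | |- Tm (fun ρ => cap _ _) => apply (Tm_app2 _ _ _ DefF2_cap)
  | |- Tm (fun ρ => iota _) => apply Tm_iota
  | |- Tm _ => first [apply Tm_sep | apply Tm_im | apply Tm_upr | apply Tm_Un | apply Tm_iota]
  end.

Lemma im_ext a F G : (forall x, x ∈ a -> F x = G x) -> DefF F -> DefF G -> im a F = im a G.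
Proof.
  intros H HF HG; apply ext; intros z; rewrite !in_im by auto.
  split; intros (x & Hx & ->); exists x; split; auto; symmetry; auto.
Qed.

(** ** Cardinal comparison *)

Definition injF (F : N -> N) A B :=
  (forall x, x ∈ A -> F x ∈ B) /\ (forall x y, x ∈ A -> y ∈ A -> F x = F y -> x = y).
Definition bijF (F : N -> N) A B := injF F A B /\ forall y, y ∈ B -> exists x, x ∈ A /\ F x = y.
Definition Leq A B := exists f, injF (ap f) A B.

Lemma Leq_intro F A B : DefF F -> injF F A B -> Leq A B.
Proof.
  intros HF [H1 H2]; exists (lam A F); split.
  - intros x Hx; rewrite ap_lam; auto.
  - intros x y Hx Hy; rewrite !ap_lam; auto.
Qed.

Lemma Leq_sub A B : Sub A B -> Leq A B.
Proof. intros H; apply (Leq_intro (fun x => x)); [df|split; auto]. Qed.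

Lemma Leq_trans A B C : Leq A B -> Leq B C -> Leq A C.
Proof.
  intros (f & H1 & H2) (g & H3 & H4).
  apply (Leq_intro (fun x => ap g (ap f x))); [df|split; auto].
Qed.

(** Taking the least preimage makes the injection definable, without choice. *)
Lemma Leq_surj L F A B : Ord L -> Sub A L -> DefF F ->
  (forall y, y ∈ B -> exists x, x ∈ A /\ F x = y) -> Leq B A.
Proof.
  intros HL HA HF H.
  assert (HD : forall y, Def1 (fun x => x ∈ A /\ F x = y)) by (intros; df).
  assert (Hs : forall y, y ∈ B ->
    least L (fun x => x ∈ A /\ F x = y) ∈ A /\ F (least L (fun x => x ∈ A /\ F x = y)) = y).
  { intros y Hy; destruct (H y Hy) as (x & Hx & Hxy).
    destruct (least_spec L (fun x => x ∈ A /\ F x = y) x) as (_ & ? & _); auto. }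
  apply (Leq_intro (fun y => least L (fun x => x ∈ A /\ F x = y))); [unfold least; df|].
  split.
  - intros y Hy; apply Hs, Hy.
  - intros y y' Hy Hy' He; rewrite <- (proj2 (Hs y Hy)), He; apply Hs, Hy'.
Qed.

Lemma bijF_isBij F A B : DefF F -> bijF F A B -> exists f, isBij f A B.
Proof.
  intros HF [[H1 H2] H3]; exists (lam A F); split; [apply isFun_lam; auto|].
  intros y Hy; destruct (H3 y Hy) as (x & Hx & <-); exists x.
  rewrite PairIn_iff, lam_pr by auto; split; auto.
  intros z; rewrite PairIn_iff, lam_pr by auto; intros [? ?]; auto.
Qed.

Lemma bijF_isBij_inv F A B : DefF F -> bijF F A B -> exists f, isBij f B A.
Proof.
  intros HF [[H1 H2] H3].
  set (R := fun p => exists x, x ∈ A /\ p = pr (F x) x).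
  assert (HR : Def1 R) by (unfold R; df).
  assert (Hp : forall x y, pr y x ∈ sep (prod B A) R <-> x ∈ A /\ y = F x).
  { intros x y; rewrite in_sep, in_prod by auto; unfold R; split.
    - intros [_ (x' & Hx' & He)]; apply pr_inj in He as [-> ->]; auto.
    - intros [Hx ->]; split; [split; auto|exists x; auto]. }
  exists (sep (prod B A) R); split; [split|].
  - intros p Hp'; rewrite in_sep in Hp' by auto; destruct Hp' as [Hp' _].
    apply in_prod_ex in Hp' as (y & x & Hy & Hx & ->); exists y, x; rewrite isOpair_iff; auto.
  - intros y Hy; destruct (H3 y Hy) as (x & Hx & <-); exists x.
    rewrite PairIn_iff, Hp; split; auto; intros z; rewrite PairIn_iff, Hp; intros [? ?]; auto.
  - intros x Hx; exists (F x); rewrite PairIn_iff, Hp; split; auto.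
    intros z; rewrite PairIn_iff, Hp; intros [? ?]; auto.
Qed.

Lemma isBij_bijF f A B : isBij f A B -> bijF (ap f) A B.
Proof.
  intros [Hf H]; split; [split|].
  - intros x Hx; apply (isFun_ap f A B); auto.
  - intros x y Hx Hy He; destruct (isFun_ap f A B x Hf Hx) as [P1 P2].
    destruct (H _ P2) as (w & _ & Hu); rewrite (Hu x), (Hu y); auto; rewrite PairIn_iff.
    + rewrite He; apply (isFun_ap f A B); auto.
    + auto.
  - intros y Hy; destruct (H y Hy) as (x & Hx & _); rewrite PairIn_iff in Hx.
    apply (isFun_pr f A B) in Hx as [Hx ->]; eauto.
Qed.

Lemma choice A B (R : N -> N -> Prop) : Def2 R ->
  (forall a, a ∈ A -> exists y, y ∈ B /\ R a y) ->
  exists f, forall a, a ∈ A -> ap f a ∈ B /\ R a (ap f a).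
Proof.
  intros HR H.
  set (K := fun a => sep (prod A B) (fun p => exists y, p = pr a y /\ R a y)).
  assert (HK : DefF K) by (unfold K; df).
  assert (inK : forall a p, p ∈ K a <-> p ∈ prod A B /\ exists y, p = pr a y /\ R a y).
  { intros a p; unfold K; apply in_sep; df. }
  destruct (ax_choice_sem (im A K)) as (f & b & Hf & Hc).
  { intros x Hx He; rewrite in_im in Hx by auto; destruct Hx as (a & Ha & ->).
    destruct (H a Ha) as (y & Hy & Hay); apply (He (pr a y)), inK; rewrite in_prod; eauto. }
  assert (Hy : forall a, a ∈ A -> exists y, ap f (K a) = pr a y /\ y ∈ B /\ R a y).
  { intros a Ha; assert (HKa : K a ∈ im A K) by (apply im_intro; auto).
    destruct (isFun_ap _ _ _ _ Hf HKa) as [P1 _]; apply PairIn_iff in P1.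
    apply Hc in P1; auto; apply inK in P1 as (P1 & y & P2 & P3).
    exists y; rewrite P2, in_prod in P1; tauto. }
  exists (lam A (fun a => iota (fun y => ap f (K a) = pr a y))).
  intros a Ha; rewrite ap_lam by (auto; df); destruct (Hy a Ha) as (y & P1 & P2 & P3).
  rewrite (iota_eq _ y); auto; intros z Hz; rewrite Hz in P1; apply pr_inj in P1; tauto.
Qed.

(** * Transfinite recursion and greedy enumeration *)

Section Recursion.

Variable L : N.
Hypothesis HL : Ord L.
Variable φ : N -> N.
Hypothesis Hφ : DefF φ.

(** An attempt at the recursion up to [a]. The step [φ] sees only the set of earlier values, which
    is all that a greedy enumeration requires. *)
Definition att g a := forall x, x ∈ a -> ap g x = φ (im x (ap g)).

Lemma att_agree g g' a a' : att g a -> att g' a' ->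
  forall x, x ∈ L -> x ∈ a -> x ∈ a' -> Sub x a -> Sub x a' -> ap g x = ap g' x.
Proof.
  intros Hg Hg'.
  apply (Ord_ind L (fun x => x ∈ a -> x ∈ a' -> Sub x a -> Sub x a' -> ap g x = ap g' x)); auto;
    [df|].
  intros x Hx IH H1 H2 H3 H4; rewrite Hg, Hg' by auto; f_equal.
  apply im_ext; try df; intros y Hy; apply IH; auto;
    intros z Hz; [apply H3|apply H4]; apply (Ord_trans L) with y; auto.
Qed.

Definition rec a := iota (fun v => exists g, att g a /\ v = φ (im a (ap g))).

Lemma DefF_rec : DefF rec.
Proof. unfold rec, att; df. Qed.

Lemma rec_att g a : a ∈ L -> att g a -> rec a = φ (im a (ap g)).
Proof.
  intros Ha Hg; unfold rec; apply iota_eq; eauto.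
  intros z (g' & Hg' & ->); f_equal; apply im_ext; try df.
  intros x Hx; apply (att_agree g' g a a); auto; try (apply (proj1 HL a); auto);
    intros y Hy; apply (Ord_trans L) with x; auto.
Qed.

Lemma att_exists a : a ∈ L -> exists g, att g a.
Proof.
  revert a; apply Ord_ind; auto; [unfold att; df|].
  intros a Ha IH; exists (lam a rec); intros x Hx; pose proof DefF_rec as HR.
  assert (xL : x ∈ L) by (apply (proj1 HL a); auto).
  rewrite ap_lam by auto; destruct (IH x Hx) as [g Hg]; rewrite (rec_att g) by auto; f_equal.
  apply im_ext; try df; intros y Hy.
  rewrite ap_lam; auto; [|apply (Ord_trans L) with x; auto].
  rewrite Hg by auto; symmetry; apply rec_att; [apply (proj1 HL x); auto|].
  intros z Hz; apply Hg, (Ord_trans L) with y; auto.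
Qed.

Lemma rec_eq a : a ∈ L -> rec a = φ (im a rec).
Proof.
  intros Ha; destruct (att_exists a Ha) as [g Hg]; pose proof DefF_rec as HR.
  rewrite (rec_att g a) by auto; f_equal; apply im_ext; try df; intros x Hx.
  rewrite Hg by auto; symmetry; apply rec_att; [apply (proj1 HL a); auto|].
  intros y Hy; apply Hg, (Ord_trans L) with x; auto.
Qed.

Variable A : N.
Hypothesis φ_new : forall D, Sub D A -> D <> A -> φ D ∈ A /\ ~ φ D ∈ D.

Lemma rec_new a : a ∈ L -> (forall b, b ∈ a \/ b = a -> im b rec <> A) ->
  rec a ∈ A /\ ~ rec a ∈ im a rec.
Proof.
  pose proof DefF_rec as HR; revert a.
  apply (Ord_ind L (fun a => (forall b, b ∈ a \/ b = a -> im b rec <> A) ->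
    rec a ∈ A /\ ~ rec a ∈ im a rec)); auto; [df|].
  intros a Ha IH H; rewrite (rec_eq a Ha) at 1 2; apply φ_new; auto.
  intros z Hz; rewrite in_im in Hz by auto; destruct Hz as (x & Hx & ->).
  apply IH; auto; intros b [Hb| ->]; apply H; left; auto; apply (Ord_trans L) with x; auto.
Qed.

(** The enumeration stops at the least [d] where [A] is used up, or at [c]. Here [c] is an initial
    segment of [L] and may be [L] itself. The selector [φ] will be a least element, a choice
    function, or a lexicographic minimum. *)
Lemma greedy c : Sub c L -> (forall x, x ∈ c -> Sub x c) ->
  exists d, (d = c \/ d ∈ c) /\ injF rec d A /\
    (forall x, x ∈ d -> ~ rec x ∈ im x rec) /\ (d = c \/ im d rec = A).
Proof.
  intros HcL Hc; pose proof DefF_rec as HR.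
  assert (K : forall d, Sub d L -> (forall x, x ∈ d -> Sub x d) ->
    (forall x, x ∈ d -> im x rec <> A) ->
    injF rec d A /\ (forall x, x ∈ d -> ~ rec x ∈ im x rec)).
  { intros d HdL Hd H.
    assert (Hn : forall x, x ∈ d -> rec x ∈ A /\ ~ rec x ∈ im x rec).
    { intros x Hx; apply rec_new; auto.
      intros b [Hb| ->]; apply H; auto; apply (Hd x); auto. }
    split; [split|]; try (intros; apply Hn; auto).
    intros x y Hx Hy He; destruct (proj2 HL x y) as [P|[P|P]]; auto; exfalso.
    - apply (proj2 (Hn y Hy)); rewrite <- He; apply im_intro; auto.
    - apply (proj2 (Hn x Hx)); rewrite He; apply im_intro; auto. }
  destruct (classic (exists x, x ∈ c /\ im x rec = A)) as [(x & Hx & Hi)|H].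
  - destruct (Ord_least L (fun x => x ∈ c /\ im x rec = A) x) as (d & Hd & [Hd1 Hd2] & Hm);
      auto; [df|].
    exists d; split; auto.
    assert (Hs : forall x, x ∈ d -> x ∈ c) by (intros y Hy; apply (Hc d); auto).
    destruct (K d) as [K1 K2]; auto.
    + intros y Hy; auto.
    + intros y Hy; apply (Ord_elem L); auto.
    + intros y Hy He; apply (Hm y); auto.
  - destruct (K c) as [K1 K2]; auto.
    + intros y Hy He; apply H; eauto.
    + exists c; auto.
Qed.

End Recursion.

(** A subset of [a] has order type at most [a]: its increasing enumeration [H] never falls below its
    argument, so an element [b] missed by [H] would have been the least candidate at step [b] at the
    latest. *)
Lemma ord_subset L a B : Ord L -> Sub a L -> (forall x, x ∈ a -> Sub x a) -> Sub B a ->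
  exists d F, (d = a \/ d ∈ a) /\ DefF F /\ bijF F d B.
Proof.
  intros HL HaL Ha HB.
  set (φ := fun D => least L (fun x => x ∈ B /\ ~ x ∈ D)).
  assert (Hφ : DefF φ) by (unfold φ, least; df).
  assert (Hs : forall D x, x ∈ B -> ~ x ∈ D ->
    φ D ∈ L /\ (φ D ∈ B /\ ~ φ D ∈ D) /\ forall z, z ∈ L -> z ∈ B /\ ~ z ∈ D -> ~ z ∈ φ D).
  { intros D x H1 H2.
    apply (least_spec L (fun x => x ∈ B /\ ~ x ∈ D) x); auto; df. }
  set (H := rec φ); assert (HR : DefF H) by (apply DefF_rec, Hφ).
  destruct (greedy L HL φ Hφ B) with (c := a) as (d & Hd & [Hi1 Hi2] & Hn & He); auto.
  { intros D HD HDB; destruct (classic (exists x, x ∈ B /\ ~ x ∈ D)) as [(x & H1 & H2)|Hx].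
    - apply (Hs D x); auto.
    - destruct HDB; apply ext; intros z; split; auto; intros Hz; apply NNPP; eauto. }
  fold H in Hi1, Hi2, Hn, He.
  exists d, H; split; auto; split; auto; split; [split; auto|].
  intros b Hb; apply NNPP; intros Hnb.
  assert (Hbi : forall x, Sub x d -> ~ b ∈ im x H).
  { intros x Hx Hb'; rewrite in_im in Hb' by auto; destruct Hb' as (y & Hy & ->); eauto. }
  assert (d = a) as ->.
  { destruct He as [He|He]; auto; exfalso; apply (Hbi d); [intros z; auto|rewrite He; auto]. }
  (* If [y = H x] were below [x], then [y ∈ H y] by the induction hypothesis and injectivity; but
     [y] was still available at step [y], against the minimality of [H y]. *)
  assert (Hge : forall x, x ∈ L -> x ∈ a -> ~ H x ∈ x).
  { apply (Ord_ind L (fun x => x ∈ a -> ~ H x ∈ x)); auto; [df|].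
    intros x Hx IH Hxa Hlt; set (y := H x) in *.
    assert (Hya : y ∈ a) by (apply (Ha x); auto).
    assert (Hyx : H y <> y).
    { intros Hyy; apply (Hn x Hxa); apply in_im; auto; exists y; split; auto. }
    destruct (Hs (im y H) b) as (P1 & P2 & P3); auto.
    rewrite <- (rec_eq L HL φ Hφ) in P1, P2, P3 by auto; fold H in P1, P2, P3.
    destruct (proj2 HL (H y) y) as [Q|[Q|Q]]; auto; [apply (IH y); auto|].
    apply (P3 y); auto; split; [apply Hi1; auto|].
    intros Hyi; apply (Hn x Hxa); rewrite in_im in Hyi by auto; destruct Hyi as (z & Hz & Hyz).
    apply in_im; auto; exists z; split; auto; apply (Ord_trans L) with y; auto. }
  assert (HbL : b ∈ L) by auto.
  destruct (Hs (im b H) b) as (P1 & P2 & P3); auto.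
  rewrite <- (rec_eq L HL φ Hφ) in P1, P2, P3 by auto; fold H in P1, P2, P3.
  destruct (proj2 HL (H b) b) as [Q|[Q|Q]]; auto.
  - apply (Hge b); auto.
  - apply Hnb; exists b; auto.
  - apply (P3 b); auto.
Qed.

(** Enumerate [A] by a choice function for [c] steps. If it is used up at some [d ∈ c], inverting
    the enumeration embeds [A] in [d]; otherwise [c] embeds in [A]. The set [A] need not consist of
    ordinals. *)
Lemma compare_choice L A c : Ord L -> Sub c L -> (forall x, x ∈ c -> Sub x c) ->
  Leq c A \/ exists d, d ∈ c /\ Leq A d.
Proof.
  intros HL HcL Hc.
  destruct (choice (sep (pow A) (fun X => X <> empty)) A (fun X y => y ∈ X)) as [f Hf]; [df| |].
  { intros X HX; rewrite in_sep in HX by df; destruct HX as [HX Hne].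
    apply not_empty in Hne as [y Hy]; exists y; split; auto.
    rewrite in_pow in HX; auto. }
  set (φ := fun D => ap f (sep A (fun x => ~ x ∈ D))).
  assert (Hφ : DefF φ) by (unfold φ; df).
  assert (HR : DefF (rec φ)) by (apply DefF_rec, Hφ).
  destruct (greedy L HL φ Hφ A) with (c := c) as (d & Hd & Hi & Hn & He); auto.
  { intros D HD HDA; destruct (Hf (sep A (fun x => ~ x ∈ D))) as [P1 P2].
    - rewrite in_sep, in_pow by df; split.
      + intros z Hz; rewrite in_sep in Hz by df; tauto.
      + intros He; apply HDA, ext; intros z; split; auto; intros Hz; apply NNPP; intros Hz'.
        apply (in_empty z); rewrite <- He, in_sep by df; auto.
    - fold (φ D) in P1, P2; rewrite in_sep in P2 by df; auto. }
  destruct (classic (im d (rec φ) = A)) as [Hs|Hs].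
  - destruct Hd as [-> | Hd].
    + left; apply (Leq_intro (rec φ)); auto.
    + right; exists d; split; auto; apply (Leq_surj L (rec φ)); auto.
      * intros x Hx; apply HcL, (Hc d); auto.
      * intros y Hy; rewrite <- Hs, in_im in Hy by auto; destruct Hy as (x & ? & ->); eauto.
  - left; destruct He as [->|He]; [|contradiction]; apply (Leq_intro (rec φ)); auto.
Qed.

(** A counting tool: [A] embeds in [c] once no proper initial segment of the lexicographic order by
    [u], [v] receives [c]. If the increasing enumeration misses [a] throughout [c], all its values
    precede [a]. *)
Lemma compare_lex L A c (u v : N -> N) : Ord L -> Sub c L -> (forall x, x ∈ c -> Sub x c) ->
  DefF u -> DefF v -> (forall x, x ∈ A -> u x ∈ L /\ v x ∈ L) ->
  (forall x y, x ∈ A -> y ∈ A -> u x = u y -> v x = v y -> x = y) ->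
  Leq A c \/
  exists a, a ∈ A /\ Leq c (sep A (fun x => u x ∈ u a \/ (u x = u a /\ v x ∈ v a))).
Proof.
  intros HL HcL Hc Hu Hv HuvL Hinj.
  set (lt := fun x y => u x ∈ u y \/ (u x = u y /\ v x ∈ v y)).
  assert (Hlt : Def2 lt) by (unfold lt; df).
  assert (lt_total : forall x y, x ∈ A -> y ∈ A -> lt x y \/ x = y \/ lt y x).
  { intros x y Hx Hy; destruct (HuvL x Hx) as [x1 x2], (HuvL y Hy) as [y1 y2]; unfold lt.
    destruct (proj2 HL (u x) (u y)) as [P|[P|P]]; auto.
    destruct (proj2 HL (v x) (v y)) as [Q|[Q|Q]]; auto. }
  set (M := fun D x => (x ∈ A /\ ~ x ∈ D) /\ forall y, y ∈ A -> ~ y ∈ D -> ~ lt y x).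
  set (φ := fun D => iota (M D)).
  assert (Hφ : DefF φ) by (unfold φ, M; df).
  assert (HM : forall D x, x ∈ A -> ~ x ∈ D -> M D (φ D)).
  { intros D x Hx HxD; apply iota_spec.
    destruct (Ord_least L (fun a => exists y, (y ∈ A /\ ~ y ∈ D) /\ u y = a) (u x))
      as (a & Ha & (y & [Hy HyD] & Hya) & Hmin); [auto|df|apply HuvL, Hx|eauto|].
    destruct (Ord_least L (fun b => exists z, (z ∈ A /\ ~ z ∈ D) /\ u z = a /\ v z = b) (v y))
      as (b & Hb & (z & [Hz HzD] & Hza & Hzb) & Hmin'); [auto|df|apply HuvL, Hy|eauto 6|].
    assert (Hzmin : forall w, w ∈ A -> ~ w ∈ D -> ~ lt w z).
    { intros w Hw HwD [Hl|[He Hl]].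
      - apply (Hmin (u w)); [apply HuvL, Hw|eauto|rewrite <- Hza; exact Hl].
      - apply (Hmin' (v w)); [apply HuvL, Hw| |rewrite <- Hzb; exact Hl].
        exists w; rewrite He; auto. }
    exists z; split; [split; auto|].
    intros w [[Hw HwD] Hwm]; destruct (lt_total w z) as [P|[P|P]]; auto.
    - destruct (Hzmin w); auto.
    - destruct (Hwm z); auto. }
  assert (HR : DefF (rec φ)) by (apply DefF_rec, Hφ).
  destruct (greedy L HL φ Hφ A) with (c := c) as (d & Hd & Hi & Hn & He); auto.
  { intros D HD HDA; destruct (classic (exists x, x ∈ A /\ ~ x ∈ D)) as [(x & H1 & H2)|Hx].
    - apply (HM D x); auto.
    - destruct HDA; apply ext; intros z; split; auto; intros Hz; apply NNPP; eauto. }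
  assert (HdL : Sub d c).
  { destruct Hd as [->|Hd]; [intros x; auto|apply Hc, Hd]. }
  destruct (classic (im d (rec φ) = A)) as [Hs|Hs].
  - left; apply Leq_trans with d; [|apply Leq_sub, HdL].
    apply (Leq_surj L (rec φ)); auto.
    + intros x Hx; auto.
    + intros y Hy; rewrite <- Hs, in_im in Hy by auto; destruct Hy as (x & ? & ->); eauto.
  - right; destruct He as [->|He]; [|contradiction].
    assert (Hex : exists a, a ∈ A /\ ~ a ∈ im c (rec φ)).
    { apply NNPP; intros Hx; apply Hs, ext; intros z; split.
      - rewrite in_im by auto; intros (x & Hx' & ->); apply Hi, Hx'.
      - intros Hz; apply NNPP; eauto. }
    destruct Hex as (a & Ha & Hna); exists a; split; auto.
    apply (Leq_intro (rec φ)); auto; split; [|apply Hi].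
    intros x Hx; rewrite in_sep by df; split; [apply Hi, Hx|].
    assert (Hax : ~ a ∈ im x (rec φ)).
    { intros H; apply Hna; rewrite in_im in * by auto; destruct H as (y & Hy & ->).
      exists y; split; auto; apply (Hc x); auto. }
    destruct (HM _ _ Ha Hax) as [[P1 P2] P3]; rewrite <- (rec_eq L HL φ Hφ) in P1, P2, P3 by auto.
    destruct (lt_total (rec φ x) a) as [P|[P|P]]; auto.
    + destruct Hna; rewrite <- P; apply im_intro; auto.
    + destruct (P3 a); auto.
Qed.

(** ** The supercompactness measure *)

Definition isUncountable k := Card k /\ exists w, isInductive w /\ w ∈ k.
Definition isCardSucc l k := Card l /\ k ∈ l /\ forall m, m ∈ l -> Card m -> ~ k ∈ m.
Definition isPkl P k l := forall x, x ∈ P <-> Sub x l /\ CardLt x k.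
Definition isUltrafilter U P :=
  (forall Y, Y ∈ U -> Sub Y P) /\
  P ∈ U /\
  (forall Y, isEmpty Y -> ~ Y ∈ U) /\
  (forall Y Z, Y ∈ U -> Sub Y Z -> Sub Z P -> Z ∈ U) /\
  (forall Y Z I, Y ∈ U -> Z ∈ U -> (forall x, x ∈ I <-> x ∈ Y /\ x ∈ Z) -> I ∈ U) /\
  (forall Y Z, Sub Y P -> (forall x, x ∈ Z <-> x ∈ P /\ ~ x ∈ Y) -> Y ∈ U \/ Z ∈ U).
Definition isNonprincipal U := forall x s, isUpair s x x -> ~ s ∈ U.
Definition isComplete U k := forall F I, Sub F U -> ~ isEmpty F -> CardLt F k ->
  (forall x, x ∈ I <-> forall Y, Y ∈ F -> x ∈ Y) -> I ∈ U.
Definition isMeasure U P k := isUltrafilter U P /\ isNonprincipal U /\ isComplete U k.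
Definition isFine U P l :=
  forall a, a ∈ l -> exists Y, Y ∈ U /\ forall x, x ∈ Y <-> x ∈ P /\ a ∈ x.
Definition isNormal U P l := forall f, isFun f P l ->
  (exists Y, Y ∈ U /\ forall x, x ∈ Y -> exists y, PairIn x y f /\ y ∈ x) ->
  exists a, a ∈ l /\ exists Y, Y ∈ U /\ forall x, x ∈ Y -> PairIn x a f.

Section Measure.

Variables k l P U : N.
Hypothesis k_uncountable : isUncountable k.
Hypothesis l_succ : isCardSucc l k.
Hypothesis P_char : isPkl P k l.
Hypothesis U_measure : isMeasure U P k.
Hypothesis U_fine : isFine U P l.
Hypothesis U_normal : isNormal U P l.

Lemma Ord_l : Ord l.
Proof. apply l_succ. Qed.

Lemma k_in_l : k ∈ l.
Proof. apply l_succ. Qed.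

Lemma l_trans x : x ∈ l -> Sub x l.
Proof. apply Ord_l. Qed.

Lemma k_sub_l : Sub k l.
Proof. apply l_trans, k_in_l. Qed.

Lemma k_trans x : x ∈ k -> Sub x k.
Proof. apply k_uncountable. Qed.

Lemma empty_in_k : empty ∈ k.
Proof.
  destruct k_uncountable as [_ (w & [(e & He & Hew) _] & Hw)].
  replace empty with e; [apply (k_trans w); auto|].
  apply ext; intros z; split; intros Hz; [destruct (He z Hz)|destruct (in_empty z Hz)].
Qed.

(** [U_normal] speaks of functions from all of [P] to [l], so the default value [empty] of [least]
    must also lie in [l]. *)
Lemma least_in_l Q : Def1 Q -> least l Q ∈ l.
Proof.
  intros HQ; destruct (classic (exists a, a ∈ l /\ Q a)) as [(a & Ha & Hn)|Hn].
  - apply (least_spec l Q a); auto; apply Ord_l.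
  - replace (least l Q) with empty; [apply k_sub_l, empty_in_k|].
    apply ext; intros w; split; intros Hw; [destruct (in_empty w Hw)|].
    unfold least in Hw; rewrite in_Un in Hw; destruct Hw as (y & Hy & _).
    rewrite in_sep in Hy by df; destruct Hy as (Hy1 & Hy & _); destruct Hn; eauto.
Qed.

Definition small x := exists a, a ∈ k /\ Leq x a.

(** The notions [Card] and [CardLt] are stated with bijections, while sizes are compared here by
    injections. Collapsing the image of the injection to its order type links the two. *)
Lemma Leq_bij x a : Sub a l -> (forall y, y ∈ a -> Sub y a) -> Leq x a ->
  exists d G, (d = a \/ d ∈ a) /\ DefF G /\ bijF G x d.
Proof.
  intros Ha Hat (f & Hf1 & Hf2).
  destruct (ord_subset l a (im x (ap f)) Ord_l Ha Hat) as (d & F & Hd & HDF & [[HF1 HF2] HF3]).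
  { intros z Hz; rewrite in_im in Hz by df; destruct Hz as (y & Hy & ->); auto. }
  assert (Hdl : forall z, z ∈ d -> z ∈ l).
  { intros z Hz; apply Ha; destruct Hd as [->|Hd]; auto; apply (Hat d); auto. }
  set (G := fun y => least l (fun z => z ∈ d /\ F z = ap f y)).
  assert (HG : forall y, y ∈ x -> G y ∈ d /\ F (G y) = ap f y).
  { intros y Hy; destruct (HF3 (ap f y)) as (z & Hz & Hzy).
    - apply (im_intro (ap f)); auto; df.
    - destruct (least_spec l (fun z => z ∈ d /\ F z = ap f y) z) as (_ & ? & _); auto;
        [apply Ord_l|df]. }
  exists d, G; split; [|split; [unfold G, least; df|split; [split|]]]; auto.
  - intros y Hy; apply HG, Hy.
  - intros y y' Hy Hy' He; apply Hf2; auto; rewrite <- (proj2 (HG y Hy)), He.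
    apply HG, Hy'.
  - intros z Hz; assert (Hz' := HF1 z Hz); rewrite in_im in Hz' by df.
    destruct Hz' as (y & Hy & Hzy); exists y; split; auto.
    apply HF2; auto; [apply HG, Hy|]; rewrite Hzy; apply HG, Hy.
Qed.

Lemma Card_Leq c a : Card c -> Sub c l -> a ∈ c -> ~ Leq c a.
Proof.
  intros [Hc Hn] Hcl Ha H.
  destruct (Leq_bij c a) as (d & G & Hd & HG & Hb); auto.
  - intros z Hz; apply Hcl, (proj1 Hc a); auto.
  - apply (proj1 (Ord_elem c a Hc Ha)).
  - apply (Hn d); [|apply (bijF_isBij_inv G); auto].
    destruct Hd as [->|Hd]; auto; apply (proj1 Hc a); auto.
Qed.

Lemma CardLt_small x : CardLt x k <-> small x.
Proof.
  split.
  - intros (a & Ha & f & Hf); exists a; split; auto; exists f; apply isBij_bijF, Hf.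
  - intros (a & Ha & H); destruct (Leq_bij x a) as (d & G & Hd & HG & Hb); auto.
    + intros z Hz; apply k_sub_l, (k_trans a); auto.
    + apply (proj1 (Ord_elem l a Ord_l (k_sub_l a Ha))).
    + exists d; split; [destruct Hd as [->|Hd]; auto; apply (k_trans a); auto|].
      apply (bijF_isBij G); auto.
Qed.

Lemma in_P x : x ∈ P <-> Sub x l /\ small x.
Proof. rewrite (P_char x), CardLt_small; reflexivity. Qed.

Lemma small_Leq x y : Leq x y -> small y -> small x.
Proof. intros H (a & Ha & H'); exists a; split; auto; apply Leq_trans with y; auto. Qed.

Lemma small_sub x y : Sub x y -> small y -> small x.
Proof. intros H; apply small_Leq, Leq_sub, H. Qed.

Lemma P_sub x y : Sub x y -> y ∈ P -> x ∈ P.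
Proof.
  rewrite !in_P; intros H [Hy Hs]; split; [intros z Hz; auto|apply small_sub with y; auto].
Qed.

Lemma P_l x : x ∈ P -> Sub x l.
Proof. intros H; apply in_P, H. Qed.

Lemma small_ord a : a ∈ k -> small a.
Proof. intros H; exists a; split; auto; apply Leq_sub; intros z; auto. Qed.

Lemma k_not_small : ~ small k.
Proof.
  intros (a & Ha & H); revert H; apply Card_Leq; auto; [apply k_uncountable|apply k_sub_l].
Qed.

(** An embedding of [A] in an ordinal singles out one element of each fiber of [F]. *)
Lemma small_surj F A B : DefF F -> (forall y, y ∈ B -> exists x, x ∈ A /\ F x = y) ->
  small A -> small B.
Proof.
  intros HDF HB (a & Ha & f & Hf1 & Hf2); exists a; split; auto.
  assert (HD : forall y, Def1 (fun z => exists x, x ∈ A /\ F x = y /\ ap f x = z)) by (intros; df).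
  set (g := fun y => least l (fun z => exists x, x ∈ A /\ F x = y /\ ap f x = z)).
  assert (Hg : forall y, y ∈ B -> exists x, x ∈ A /\ F x = y /\ ap f x = g y).
  { intros y Hy; destruct (HB y Hy) as (x & Hx & Hxy).
    destruct (least_spec l (fun z => exists x, x ∈ A /\ F x = y /\ ap f x = z) (ap f x))
      as (_ & H & _); eauto; [apply Ord_l|].
    apply k_sub_l, (k_trans a); auto. }
  apply (Leq_intro g); [unfold g, least; df|split].
  - intros y Hy; destruct (Hg y Hy) as (x & Hx & _ & <-); auto.
  - intros y y' Hy Hy' He; destruct (Hg y Hy) as (x & Hx & <- & H1).
    destruct (Hg y' Hy') as (x' & Hx' & <- & H2); f_equal; apply Hf2; congruence.
Qed.

Lemma small_im F A : DefF F -> small A -> small (im A F).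
Proof.
  intros HDF; apply (small_surj F); auto.
  intros y Hy; rewrite in_im in Hy by auto; destruct Hy as (x & ? & ->); eauto.
Qed.

(** * Properties of almost all members of [P] *)

Definition Uae (φ : N -> Prop) := exists Y, Y ∈ U /\ forall z, z ∈ Y -> φ z.

Lemma U_P Y : Y ∈ U -> Sub Y P.
Proof. apply U_measure. Qed.

Lemma P_in_U : P ∈ U.
Proof. apply U_measure. Qed.

Lemma Uae_mono φ ψ : (forall z, z ∈ P -> φ z -> ψ z) -> Uae φ -> Uae ψ.
Proof.
  intros H (Y & HY & Hz); exists Y; split; auto; intros z Hz'; apply H; auto.
  apply (U_P Y); auto.
Qed.

Lemma Uae_all (φ : N -> Prop) : (forall z, z ∈ P -> φ z) -> Uae φ.
Proof. exists P; split; [apply P_in_U|auto]. Qed.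

Lemma Uae_and φ ψ : Uae φ -> Uae ψ -> Uae (fun z => φ z /\ ψ z).
Proof.
  intros (Y & HY & H) (Z & HZ & H'); exists (cap Y Z); split.
  - destruct U_measure as ((_ & _ & _ & _ & HI & _) & _); apply (HI Y Z); auto.
    intros x; apply in_cap.
  - intros z Hz; apply in_cap in Hz as [? ?]; auto.
Qed.

Lemma Uae_ex φ : Uae φ -> exists z, z ∈ P /\ φ z.
Proof.
  intros (Y & HY & H); apply NNPP; intros Hn.
  destruct U_measure as ((_ & _ & He & _) & _); apply (He Y); auto.
  intros z Hz; apply Hn; exists z; split; auto; apply (U_P Y); auto.
Qed.

Lemma Uae_not (φ : N -> Prop) : Uae φ -> ~ Uae (fun z => ~ φ z).
Proof.
  intros H H'; destruct (Uae_ex _ (Uae_and _ _ H H')) as (z & _ & Hz); tauto.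
Qed.

(** [Uae] asks only for some member of [U] below [φ] and so applies to any predicate; definability
    is what makes the full extension of [φ] a member of [U]. *)
Lemma Uae_set φ : Def1 φ -> Uae φ -> sep P φ ∈ U.
Proof.
  intros Hφ (Y & HY & H).
  destruct U_measure as ((_ & _ & _ & Hu & _) & _); apply (Hu Y); auto.
  - intros z Hz; rewrite in_sep by auto; split; auto; apply (U_P Y); auto.
  - intros z Hz; rewrite in_sep in Hz by auto; tauto.
Qed.

Lemma Uae_em φ : Def1 φ -> Uae φ \/ Uae (fun z => ~ φ z).
Proof.
  intros Hφ; destruct U_measure as ((_ & _ & _ & _ & _ & Hu) & _).
  destruct (Hu (sep P φ) (sep P (fun z => ~ φ z))) as [H|H].
  - intros z Hz; rewrite in_sep in Hz by auto; tauto.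
  - intros x; rewrite !in_sep by df; tauto.
  - left; exists (sep P φ); split; auto; intros z Hz; rewrite in_sep in Hz by auto; tauto.
  - right; exists (sep P (fun z => ~ φ z)); split; auto; intros z Hz.
    rewrite in_sep in Hz by df; tauto.
Qed.

Lemma Uae_fine a : a ∈ l -> Uae (fun z => a ∈ z).
Proof.
  intros Ha; destruct (U_fine a Ha) as (Y & HY & H); exists Y; split; auto.
  intros z Hz; apply H, Hz.
Qed.

Lemma Uae_complete R A : Def2 R -> small A -> (forall a, a ∈ A -> Uae (R a)) ->
  Uae (fun z => forall a, a ∈ A -> R a z).
Proof.
  intros HR HA H.
  destruct (classic (A = empty)) as [->|Hne].
  { apply Uae_all; intros z _ a Ha; destruct (in_empty a Ha). }
  apply not_empty in Hne as [a0 Ha0].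
  assert (HD : forall a, Def1 (R a)) by (intros; df).
  assert (HDF : DefF (fun a => sep P (R a))) by df.
  exists (sep P (fun z => forall a, a ∈ A -> R a z)); split.
  - destruct U_measure as (_ & _ & Hc); apply (Hc (im A (fun a => sep P (R a)))).
    + intros Y HY; rewrite in_im in HY by auto; destruct HY as (a & Ha & ->).
      apply Uae_set; auto.
    + intros He; apply (He (sep P (R a0))), (im_intro (fun a => sep P (R a))); auto.
    + apply CardLt_small, small_im; auto.
    + intros x; rewrite in_sep by df; split.
      * intros [Hx HRx] Y HY; rewrite in_im in HY by auto; destruct HY as (a & Ha & ->).
        rewrite in_sep by auto; auto.
      * intros HY; assert (Hx : forall a, a ∈ A -> x ∈ P /\ R a x).
        { intros a Ha; rewrite <- in_sep by auto.
          apply HY, (im_intro (fun a => sep P (R a))); auto. }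
        split; [apply (Hx a0); auto|intros a Ha; apply Hx; auto].
  - intros z Hz; rewrite in_sep in Hz by df; apply Hz.
Qed.

(** Closure under diagonal intersections. Otherwise the least [a ∈ z] with [R a z] false is a
    regressive function of [z], almost everywhere equal to one [a] by normality, and [R a] would
    fail almost everywhere. *)
Lemma Uae_normal R : Def2 R -> (forall a, a ∈ l -> Uae (R a)) ->
  Uae (fun z => forall a, a ∈ z -> R a z).
Proof.
  intros HR H; destruct (Uae_em (fun z => forall a, a ∈ z -> R a z)) as [Hz|Hz]; auto; [df|].
  exfalso.
  set (g := fun z => least l (fun a => a ∈ z /\ ~ R a z)).
  assert (Hg : DefF g) by (unfold g, least; df).
  assert (HD : forall z, Def1 (fun a => a ∈ z /\ ~ R a z)) by (intros; df).
  assert (Hgs : forall z a, z ∈ P -> a ∈ z -> ~ R a z -> g z ∈ l /\ g z ∈ z /\ ~ R (g z) z).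
  { intros z a Hz1 Ha Hn.
    destruct (least_spec l (fun a => a ∈ z /\ ~ R a z) a) as (? & ? & _); auto; [apply Ord_l|].
    apply (P_l z); auto. }
  assert (Hgl : forall z, g z ∈ l) by (intros z; apply least_in_l, HD).
  assert (Hz' : Uae (fun z => g z ∈ z /\ ~ R (g z) z)).
  { revert Hz; apply Uae_mono; intros z Hz1 Hz2; apply not_all_ex_not in Hz2 as [a Ha].
    apply imply_to_and in Ha as [Ha Hn]; apply (Hgs z a); auto. }
  destruct (U_normal (lam P g)) as (a & Ha & Y & HY & HYa).
  - apply isFun_lam; auto.
  - destruct Hz' as (Y & HY & HYz); exists Y; split; auto; intros z Hz1.
    exists (g z); rewrite PairIn_iff, lam_pr by auto; split; [|apply HYz, Hz1].
    split; auto; apply (U_P Y); auto.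
  - apply (Uae_not _ (H a Ha)).
    assert (HU : Uae (fun z => g z = a)).
    { exists Y; split; auto; intros z Hz1; specialize (HYa z Hz1).
      rewrite PairIn_iff, lam_pr in HYa by auto; symmetry; apply HYa. }
    generalize (Uae_and _ _ Hz' HU); apply Uae_mono; intros z _ [[_ P1] <-]; exact P1.
Qed.

(** * Closure of [P] under small unions, and [k] as a strong limit *)

Lemma Uae_sub y : y ∈ P -> Uae (fun z => Sub y z).
Proof.
  intros Hy; apply in_P in Hy as [Hy1 Hy2].
  apply (Uae_complete (fun a z => a ∈ z)); auto; [df|].
  intros a Ha; apply Uae_fine; auto.
Qed.

(** This carries the regularity of [k]: by fineness and completeness almost every [z] contains all
    members of a small family, so its union is a subset of one element of [P]. *)
Lemma P_directed A F : DefF F -> small A -> (forall a, a ∈ A -> F a ∈ P) ->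
  exists z, z ∈ P /\ forall a, a ∈ A -> Sub (F a) z.
Proof.
  intros HDF HA H; apply Uae_ex, (Uae_complete (fun a z => Sub (F a) z)); auto; [df|].
  intros a Ha; apply Uae_sub; auto.
Qed.

Lemma P_cup x y : x ∈ P -> y ∈ P -> cup x y ∈ P.
Proof.
  intros Hx Hy; destruct (Uae_ex _ (Uae_and _ _ (Uae_sub x Hx) (Uae_sub y Hy)))
    as (z & Hz & Hxz & Hyz).
  apply P_sub with z; auto; intros w Hw; apply in_cup in Hw as [Hw|Hw]; auto.
Qed.

Lemma P_upr a b : a ∈ l -> b ∈ l -> upr a b ∈ P.
Proof.
  intros Ha Hb; destruct (Uae_ex _ (Uae_and _ _ (Uae_fine a Ha) (Uae_fine b Hb)))
    as (z & Hz & Hxz & Hyz).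
  apply P_sub with z; auto; intros w Hw; apply in_upr in Hw as [->| ->]; auto.
Qed.

Lemma P_union A F : DefF F -> small A -> (forall a, a ∈ A -> F a ∈ P) -> Un (im A F) ∈ P.
Proof.
  intros HDF HA H; destruct (P_directed A F) as (z & Hz & Hs); auto.
  apply P_sub with z; auto; intros w Hw; apply in_Un in Hw as (y & Hy & Hw).
  rewrite in_im in Hy by auto; destruct Hy as (a & Ha & ->); apply (Hs a); auto.
Qed.

(* For an injective sequence [i] of [k] subsets of [γ] and [h z] the least ordinal
   below [k] outside [z], completeness makes [i (h z)] constant almost everywhere,
   hence also [h z]; but every ordinal belongs to almost all [z]. *)
Lemma small_pow_ord γ : γ ∈ k -> small (pow γ).
Proof.
  intros Hγ; destruct (compare_choice l (pow γ) k Ord_l k_sub_l k_trans) as [(i & Hi1 & Hi2)|H];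
    [exfalso|exact H].
  set (h := fun z => least l (fun x => x ∈ k /\ ~ x ∈ z)).
  assert (Hh : DefF h) by (unfold h, least; df).
  assert (Hhs : forall z, z ∈ P -> h z ∈ k /\ ~ h z ∈ z).
  { intros z Hz; destruct (classic (exists x, x ∈ k /\ ~ x ∈ z)) as [(x & Hx & Hxz)|Hn].
    - destruct (least_spec l (fun x => x ∈ k /\ ~ x ∈ z) x) as (_ & ? & _); auto;
        [apply Ord_l|df|apply k_sub_l; auto].
    - destruct k_not_small; apply small_sub with z; [|apply in_P, Hz].
      intros x Hx; apply NNPP; eauto. }
  set (Q := fun b => Uae (fun z => b ∈ ap i (h z))).
  assert (HQ : Def1 Q) by (unfold Q, Uae; df).
  assert (HB : Uae (fun z => forall b, b ∈ γ -> (b ∈ ap i (h z) <-> Q b))).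
  { apply (Uae_complete (fun b z => b ∈ ap i (h z) <-> Q b)); [df|apply small_ord, Hγ|].
    intros b _; destruct (Uae_em (fun z => b ∈ ap i (h z))) as [H|H]; [df| |].
    - assert (Q b) by exact H; revert H; apply Uae_mono; tauto.
    - assert (~ Q b) by (intros H'; exact (Uae_not _ H' H)).
      revert H; apply Uae_mono; tauto. }
  destruct (Uae_ex _ HB) as (z0 & Hz0 & HB0); destruct (Hhs z0 Hz0) as [P1 _].
  destruct (Uae_ex _ (Uae_and _ _ HB (Uae_fine (h z0) (k_sub_l _ P1)))) as (z & Hz & Hz1 & Hz2).
  destruct (Hhs z Hz) as [P2 P3]; apply P3; replace (h z) with (h z0); auto.
  apply Hi2; auto; apply ext; intros b.
  assert (Hb0 := proj1 (in_pow γ _) (Hi1 _ P1)); assert (Hb := proj1 (in_pow γ _) (Hi1 _ P2)).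
  split; intros Hb1; assert (Hbγ : b ∈ γ) by auto.
  - apply Hz1, HB0; auto.
  - apply HB0, Hz1; auto.
Qed.

Lemma im_inj f x y u v : injF (ap f) x y -> Sub u x -> Sub v x ->
  im u (ap f) = im v (ap f) -> u = v.
Proof.
  intros [_ Hf].
  assert (K : forall u v, Sub u x -> Sub v x -> im u (ap f) = im v (ap f) -> Sub u v).
  { clear u v; intros u v Hu Hv He w Hw.
    assert (H : ap f w ∈ im v (ap f)) by (rewrite <- He; apply im_intro; [df|auto]).
    rewrite in_im in H by df; destruct H as (w' & Hw' & H).
    rewrite (Hf w w'); auto. }
  intros Hu Hv He; apply ext; intros w; split; apply K; auto.
Qed.

Lemma Leq_pow x y : Leq x y -> Leq (pow x) (pow y).
Proof.
  intros (f & Hf); apply (Leq_intro (fun u => im u (ap f))); [df|split].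
  - intros u Hu; rewrite in_pow in *; intros z Hz; rewrite in_im in Hz by df.
    destruct Hz as (w & Hw & ->); apply Hf; auto.
  - intros u v Hu Hv; apply (im_inj f x y); auto; apply in_pow; auto.
Qed.

Lemma small_pow x : small x -> small (pow x).
Proof.
  intros (a & Ha & H); apply small_Leq with (pow a); [apply Leq_pow, H|].
  apply small_pow_ord, Ha.
Qed.

(** * Cardinal arithmetic below [l] and the injection of [P] into [l] *)

Definition ite (c : Prop) (a b : N) : N := iota (fun v => (c /\ v = a) \/ (~ c /\ v = b)).

Lemma ite_true (c : Prop) a b : c -> ite c a b = a.
Proof. intros H; apply iota_eq; [auto|intros z [?|?]; tauto]. Qed.

Lemma ite_false (c : Prop) a b : ~ c -> ite c a b = b.
Proof. intros H; apply iota_eq; [auto|intros z [?|?]; tauto]. Qed.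

Lemma l_not_Leq a : a ∈ l -> ~ Leq l a.
Proof. apply Card_Leq; [apply l_succ|intros z; auto]. Qed.

(* Order [l] lexicographically by [(F x, x)]: initial segments would be small, so the
   order would embed in [k]. *)
Lemma big_fiber F : DefF F -> (forall x, x ∈ l -> F x ∈ k) ->
  exists η, η ∈ k /\ ~ small (sep l (fun x => F x = η)).
Proof.
  intros HDF HFk; apply NNPP; intros Hn.
  set (fib := fun η => sep l (fun x => F x = η)).
  assert (Hfib : DefF fib) by (unfold fib; df).
  assert (in_fib : forall η x, x ∈ fib η <-> x ∈ l /\ F x = η) by
    (intros η x; unfold fib; rewrite in_sep by df; reflexivity).
  assert (HfP : forall η, η ∈ k -> fib η ∈ P).
  { intros η Hη; apply in_P; split; [intros x Hx; apply in_fib in Hx; tauto|].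
    apply NNPP; intros Hs; apply Hn; exists η; auto. }
  destruct (compare_lex l l k F (fun x => x) Ord_l k_sub_l k_trans) as [H|(a & Ha & H)]; auto;
    [df| | |].
  - intros x Hx; split; auto; apply k_sub_l; auto.
  - revert H; apply l_not_Leq, k_in_l.
  - apply k_not_small; apply small_Leq with (1 := H).
    apply small_sub with (cup (Un (im (F a) fib)) (fib (F a))).
    + intros x Hx; rewrite in_sep in Hx by df; destruct Hx as [Hx [Hxa|[Hxa _]]].
      * apply in_cup; left; apply in_Un; exists (fib (F x)).
        split; [apply im_intro; auto|apply in_fib; auto].
      * apply in_cup; right; apply in_fib; auto.
    + apply in_P, P_cup; auto; apply P_union; auto; [apply small_ord; auto|].
      intros b Hb; apply HfP, (k_trans (F a)); auto.
Qed.

(** The least ordinal that receives [a] is a cardinal below [l], and no cardinal lies strictly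
    between [k] and [l]. *)
Lemma Leq_k a : a ∈ l -> Leq a k.
Proof.
  intros Ha.
  destruct (Ord_least l (fun d => Leq a d) a Ord_l) as (d & Hd & Had & Hm); auto.
  { unfold Leq, injF; df. }
  { apply Leq_sub; intros z; auto. }
  assert (Hc : Card d).
  { split; [apply (Ord_elem l); auto; apply Ord_l|].
    intros b Hb (f & Hf); apply (Hm b); auto; [apply (l_trans d); auto|].
    apply Leq_trans with d; auto; apply isBij_bijF in Hf as [_ Hf].
    apply (Leq_surj l (ap f)); auto; [apply Ord_l|apply l_trans, (l_trans d); auto|df]. }
  apply Leq_trans with d; auto; apply Leq_sub.
  destruct (proj2 Ord_l d k Hd k_in_l) as [H|[->|H]]; [apply k_trans, H|intros z; auto|].
  destruct l_succ as (_ & _ & Hs); destruct (Hs d); auto.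
Qed.

(** The common superset [T] of the domains provides one set, [pow (prod T B)], from which all
    embeddings are chosen. *)
Lemma choose_embeddings A (D : N -> N) B T : DefF D ->
  (forall a, a ∈ A -> Sub (D a) T) -> (forall a, a ∈ A -> Leq (D a) B) ->
  exists e, forall a, a ∈ A -> injF (ap (ap e a)) (D a) B.
Proof.
  intros HD HT H.
  destruct (choice A (pow (prod T B)) (fun a f => injF (ap f) (D a) B)) as [e He].
  - unfold injF; df.
  - intros a Ha; destruct (H a Ha) as [f Hf]; exists (lam (D a) (ap f)); split.
    + apply in_pow; intros p Hp; unfold lam in Hp; rewrite in_im in Hp by df.
      destruct Hp as (x & Hx & ->); apply in_prod; split; [apply (HT a); auto|].
      apply Hf, Hx.
    + destruct Hf as [Hf1 Hf2]; split; [intros x Hx|intros x y Hx Hy];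
        rewrite ?ap_lam by (auto; df); auto.
  - exists e; intros a Ha; apply He, Ha.
Qed.

Lemma embeddings_k : exists e, forall a, a ∈ l -> injF (ap (ap e a)) a k.
Proof.
  apply (choose_embeddings l (fun a => a) k l); [df|apply l_trans|apply Leq_k].
Qed.

(** Regularity of [l]. If [x] were unbounded, send [z] to its image in [k] under the embedding of
    [μ z], the first element of [x] not below [z]. In one fiber each [a ∈ x] accounts only for [a]
    itself and for at most one ordinal below [a], so all fibers would be small, against
    [big_fiber]. *)
Lemma P_bounded x : x ∈ P -> exists a, a ∈ l /\ Sub x a.
Proof.
  intros Hx; apply NNPP; intros Hn; destruct embeddings_k as [e He].
  set (μ := fun z => least l (fun a => a ∈ x /\ (z ∈ a \/ z = a))).
  assert (Hμ : DefF μ) by (unfold μ, least; df).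
  assert (Hμs : forall z, z ∈ l -> μ z ∈ x /\ (z ∈ μ z \/ z = μ z)).
  { intros z Hz; assert (Ha : exists a, a ∈ x /\ ~ a ∈ z).
    { apply NNPP; intros Ha; apply Hn; exists z; split; auto.
      intros a Hax; apply NNPP; eauto. }
    destruct Ha as (a & Hax & Haz); assert (Hal := P_l x Hx a Hax).
    apply (least_spec l (fun a => a ∈ x /\ (z ∈ a \/ z = a)) a); auto; [apply Ord_l|df|].
    split; auto; destruct (proj2 Ord_l z a) as [?|[?|?]]; tauto. }
  (* For [z ∈ x] one has [μ z = z], and [z] is outside the domain of the embedding; the default is
     [empty]. *)
  set (G := fun z => ite (z ∈ μ z) (ap (ap e (μ z)) z) empty).
  destruct (big_fiber G) as (η & Hη & Hs).
  - unfold G, ite; df.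
  - intros z Hz; destruct (Hμs z Hz) as [H1 H2]; unfold G.
    destruct (classic (z ∈ μ z)) as [H|H]; [rewrite ite_true|rewrite ite_false]; auto.
    + apply He; auto; apply (P_l x); auto.
    + apply empty_in_k.
  - assert (HG : DefF G) by (unfold G, ite; df).
    set (K := fun a => least l (fun z => z ∈ a /\ ap (ap e a) z = η)).
    assert (HK : DefF K) by (unfold K, least; df).
    apply Hs, small_sub with (Un (im x (fun a => upr a (K a)))).
    + intros z Hz; rewrite in_sep in Hz by df; destruct Hz as [Hz Hzη].
      apply in_Un; exists (upr (μ z) (K (μ z))); destruct (Hμs z Hz) as [H1 H2].
      split; [apply (im_intro (fun a => upr a (K a))); auto; df|].
      apply in_upr; destruct H2 as [H2|H2]; auto; right.
      unfold G in Hzη; rewrite ite_true in Hzη by auto.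
      destruct (least_spec l (fun y => y ∈ μ z /\ ap (ap e (μ z)) y = η) z)
        as (_ & [H3 H4] & _); auto; [apply Ord_l|df|].
      fold (K (μ z)) in H3, H4; apply (He (μ z)); auto; [apply (P_l x); auto|congruence].
    + apply in_P, P_union; [df|apply in_P, Hx|].
      intros a Ha; apply P_upr; [apply (P_l x); auto|apply least_in_l; df].
Qed.

(** The successors of the elements of an unbounded [y] cover [k], so a small [y] would make [k]
    small. *)
Lemma k_regular y : Sub y k -> small y -> exists η, η ∈ k /\ Sub y η.
Proof.
  intros Hy Hs; apply NNPP; intros Hn; apply k_not_small.
  apply small_sub with (Un (im y (fun z => cup z (upr z z)))).
  - intros x Hx; assert (Hz : exists z, z ∈ y /\ ~ z ∈ x).
    { apply NNPP; intros Hz; apply Hn; exists x; split; auto.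
      intros z Hzy; apply NNPP; eauto. }
    destruct Hz as (z & Hz & Hzx); apply in_Un; exists (cup z (upr z z)).
    split; [apply (im_intro (fun z => cup z (upr z z))); auto; df|].
    rewrite in_cup, in_upr.
    destruct (proj2 Ord_l x z) as [?|[?|?]]; auto; try (apply k_sub_l; auto); tauto.
  - apply in_P, P_union; auto; [df|]; intros z Hz; apply P_cup.
    + apply in_P; split; [apply l_trans, k_sub_l; auto|apply small_ord; auto].
    + apply P_upr; apply k_sub_l; auto.
Qed.

Definition Pbelow a := sep P (fun x => Sub x a).

Lemma in_Pbelow a x : x ∈ Pbelow a <-> x ∈ P /\ Sub x a.
Proof. unfold Pbelow; apply (in_sep (fun x => Sub x a)); df. Qed.

(** An embedding of [a] in [k] turns small subsets of [a] into bounded subsets of [k]. Sorted by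
    their least bound [η], they form fibers that embed in [pow η], which is small; [big_fiber]
    forbids this for [l] many sets. *)
Lemma l_not_Leq_Pbelow a : a ∈ l -> ~ Leq l (Pbelow a).
Proof.
  intros Ha (i & Hi1 & Hi2); destruct (Leq_k a Ha) as (ε & Hε1 & Hε2).
  set (Y := fun x => im (ap i x) (ap ε)).
  assert (HY : DefF Y) by (unfold Y; df).
  assert (HYs : forall x, x ∈ l -> Sub (Y x) k /\ small (Y x)).
  { intros x Hx; destruct (proj1 (in_Pbelow _ _) (Hi1 x Hx)) as [H1 H2]; split.
    - intros z Hz; unfold Y in Hz; rewrite in_im in Hz by df; destruct Hz as (w & Hw & ->); auto.
    - apply small_im; [df|apply in_P, H1]. }
  set (g := fun x => least l (fun η => η ∈ k /\ Sub (Y x) η)).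
  assert (Hg : DefF g) by (unfold g, least; df).
  assert (Hgs : forall x, x ∈ l -> g x ∈ k /\ Sub (Y x) (g x)).
  { intros x Hx; destruct (HYs x Hx) as [H1 H2].
    destruct (k_regular (Y x) H1 H2) as (η & Hη & Hs).
    apply (least_spec l (fun η => η ∈ k /\ Sub (Y x) η) η); auto; [apply Ord_l|df|].
    apply k_sub_l, Hη. }
  destruct (big_fiber g) as (η & Hη & Hs); auto; [intros x Hx; apply Hgs, Hx|].
  apply Hs, small_Leq with (pow η); [|apply small_pow_ord, Hη].
  apply (Leq_intro Y); auto; split.
  - intros x Hx; rewrite in_sep in Hx by df; destruct Hx as [Hx <-].
    apply in_pow, Hgs, Hx.
  - intros x y Hx Hy; rewrite in_sep in Hx, Hy by df; destruct Hx as [Hx _], Hy as [Hy _].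
    intros He; apply Hi2; auto; apply (im_inj ε a k); [split; auto| | |exact He];
      apply (proj1 (in_Pbelow a _)), Hi1; auto.
Qed.

(** Order [P] by the least bound [b x] and then by an embedding of [Pbelow (b x)] in [l]. The
    predecessors of [y] all lie in [Pbelow (b y)], which does not receive [l], so [compare_lex]
    applies. *)
Lemma P_Leq_l : Leq P l.
Proof.
  destruct (choose_embeddings l Pbelow l P) as [e He].
  - unfold Pbelow; df.
  - intros a Ha x Hx; apply in_Pbelow in Hx; tauto.
  - intros a Ha; destruct (compare_choice l (Pbelow a) l Ord_l) as [H|(d & Hd & H)];
      [intros z; auto|apply l_trans| |].
    + destruct (l_not_Leq_Pbelow a Ha H).
    + apply Leq_trans with d; auto; apply Leq_sub, l_trans, Hd.
  - set (b := fun x => least l (fun a => Sub x a)).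
    assert (Hb : DefF b) by (unfold b, least; df).
    assert (Hbs : forall x, x ∈ P -> b x ∈ l /\ x ∈ Pbelow (b x)).
    { intros x Hx; destruct (P_bounded x Hx) as (a & Ha & Hxa).
      destruct (least_spec l (fun a => Sub x a) a) as (H1 & H2 & _); auto; [apply Ord_l|df|].
      split; auto; apply in_Pbelow; auto. }
    destruct (compare_lex l P l b (fun x => ap (ap e (b x)) x) Ord_l)
      as [H|(y & Hy & H)]; auto.
    + intros z; auto.
    + apply l_trans.
    + df.
    + intros x Hx; destruct (Hbs x Hx) as [H1 H2]; split; auto; apply He; auto.
    + intros x y Hx Hy Hbe Hve; destruct (Hbs x Hx) as [H1 H2], (Hbs y Hy) as [H3 H4].
      rewrite <- Hbe in *; apply (He (b x)); auto.
    + exfalso; apply (l_not_Leq_Pbelow (b y)); [apply Hbs, Hy|].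
      apply Leq_trans with (1 := H), Leq_sub.
      intros x Hx; rewrite in_sep in Hx by df; destruct Hx as [Hx Hl'].
      apply in_Pbelow; split; auto; intros z Hz.
      destruct (Hbs x Hx) as [H1 H2]; apply in_Pbelow in H2 as [_ H2].
      destruct Hl' as [Hl'|[<- _]]; auto.
      apply (Ord_trans l) with (b x); auto; [apply Ord_l|apply Hbs, Hy].
Qed.

(* If all [e(x ∪ {γ})] with [γ] above [a] were below [m], gluing embeddings of [a] and
   of [m] into [k] would give a map [l → k] with fibers of size at most two. *)
Lemma extend_above e x a m : injF (ap e) P l -> x ∈ P -> a ∈ l -> Sub x a -> m ∈ l ->
  exists γ, γ ∈ l /\ ~ γ ∈ a /\ ~ ap e (cup x (upr γ γ)) ∈ m.
Proof.
  intros [He1 He2] Hx Ha Hxa Hm; apply NNPP; intros Hn.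
  destruct (Leq_k a Ha) as (f & Hf1 & Hf2), (Leq_k m Hm) as (g & Hg1 & Hg2).
  set (val := fun γ => ap e (cup x (upr γ γ))).
  assert (Hval : DefF val) by (unfold val; df).
  assert (Hvm : forall γ, γ ∈ l -> ~ γ ∈ a -> val γ ∈ m) by
    (intros γ H1 H2; apply NNPP; intros H3; apply Hn; eauto).
  assert (Hvi : forall γ γ', γ ∈ l -> γ' ∈ l -> ~ γ ∈ a -> val γ = val γ' -> γ = γ').
  { intros γ γ' H1 H2 H3 Hv; apply He2 in Hv; try (apply P_cup, P_upr; auto).
    assert (H : γ ∈ cup x (upr γ γ)) by (apply in_cup; rewrite in_upr; auto).
    rewrite Hv, in_cup, in_upr in H; destruct H as [H|[H|H]]; auto; destruct H3; auto. }
  set (F := fun γ => ite (γ ∈ a) (ap f γ) (ap g (val γ))).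
  assert (HDF : DefF F) by (unfold F, ite; df).
  destruct (big_fiber F) as (η & Hη & Hs); auto.
  - intros γ Hγ; unfold F; destruct (classic (γ ∈ a)) as [H|H];
      [rewrite ite_true|rewrite ite_false]; auto.
  - set (Q1 := fun γ => γ ∈ a /\ ap f γ = η); set (Q2 := fun γ => ~ γ ∈ a /\ ap g (val γ) = η).
    assert (HQ1 : Def1 Q1) by (unfold Q1; df). assert (HQ2 : Def1 Q2) by (unfold Q2; df).
    apply Hs, small_sub with (upr (least l Q1) (least l Q2)).
    + intros γ Hγ; rewrite in_sep in Hγ by df; destruct Hγ as [Hγ Hγη]; unfold F in Hγη.
      apply in_upr; destruct (classic (γ ∈ a)) as [H|H];
        [rewrite ite_true in Hγη by auto; left|rewrite ite_false in Hγη by auto; right].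
      * destruct (least_spec l Q1 γ) as (H1 & [H2 H3] & _); auto; [apply Ord_l|split; auto|].
        apply Hf2; auto; congruence.
      * destruct (least_spec l Q2 γ) as (H1 & [H2 H3] & _); auto; [apply Ord_l|split; auto|].
        apply Hvi; auto; apply Hg2; auto; congruence.
    + apply in_P, P_upr; apply least_in_l; auto.
Qed.

(* Codes for the sets of the model: as [x ⊆ s(x)], membership in coded sets follows [∈]
   on ordinals and is well-founded. *)
Lemma coding : exists s, injF (ap s) P l /\ (forall x, x ∈ P -> Sub x (ap s x)) /\
  (forall a, a ∈ k -> ap s a = a).
Proof.
  destruct P_Leq_l as [e He]; pose proof He as [He1 He2].
  set (b := fun x => least l (fun a => Sub x a)).
  assert (Hb : DefF b) by (unfold b, least; df).
  assert (Hbs : forall x, x ∈ P -> b x ∈ l /\ Sub x (b x)).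
  { intros x Hx; destruct (P_bounded x Hx) as (a & Ha & Hxa).
    destruct (least_spec l (fun a => Sub x a) a) as (H1 & H2 & _); auto; [apply Ord_l|df]. }
  set (val := fun x γ => ap e (cup x (upr γ γ))).
  assert (Hval : DefF2 val) by (unfold val; df).
  (* The code of [x] will be [e] of [x] with one extra ordinal [γ] added. The ordinal lies beyond
     the bound of [x] so that it can be recognised, and the code lies beyond that bound and outside
     [k]. *)
  set (Q := fun x γ => ~ γ ∈ b x /\ ~ val x γ ∈ b x /\ ~ val x γ ∈ k).
  assert (HQ : Def2 Q) by (unfold Q; df).
  assert (HQx : forall x, Def1 (Q x)) by (intros x; df).
  set (c := fun x => least l (Q x)).
  assert (Hc : DefF c) by (unfold c, least; df).
  assert (Hcs : forall x, x ∈ P -> c x ∈ l /\ Q x (c x)).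
  { intros x Hx; destruct (Hbs x Hx) as [H1 H2].
    assert (H : exists m, m ∈ l /\ Sub (b x) m /\ Sub k m).
    { destruct (proj2 Ord_l (b x) k H1 k_in_l) as [H|[H|H]].
      - exists k; split; [apply k_in_l|split; [apply k_trans, H|intros z; auto]].
      - exists k; split; [apply k_in_l|rewrite H; split; intros z; auto].
      - exists (b x); split; [auto|split; [intros z; auto|]].
        intros z Hz; apply (Ord_trans l) with k; auto; apply Ord_l. }
    destruct H as (m & Hm & Hbm & Hkm).
    destruct (extend_above e x (b x) m) as (γ & Hγ & Hγb & Hγm); auto.
    destruct (least_spec l (Q x) γ) as (H3 & H4 & _); auto; [apply Ord_l|].
    split; [|split]; auto. }
  set (S0 := fun x => val x (c x)).
  assert (HS0 : forall x, x ∈ P -> S0 x ∈ l /\ ~ S0 x ∈ b x /\ ~ S0 x ∈ k).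
  { intros x Hx; destruct (Hcs x Hx) as (H1 & H2 & H3); split; auto.
    apply He1, P_cup, P_upr; auto. }
  assert (HS0i : forall x y, x ∈ P -> y ∈ P -> S0 x = S0 y -> x = y).
  { intros x y Hx Hy Hxy; destruct (Hcs x Hx) as (H1 & H2 & _), (Hcs y Hy) as (H3 & H4 & _).
    destruct (Hbs x Hx) as [B1 B2], (Hbs y Hy) as [B3 B4].
    apply He2 in Hxy; try (apply P_cup, P_upr; auto).
    assert (K : forall z, (z ∈ x \/ z = c x) <-> (z ∈ y \/ z = c y)).
    { intros z; transitivity (z ∈ cup x (upr (c x) (c x))); [|rewrite Hxy];
        rewrite in_cup, in_upr; tauto. }
    (* The added ordinal is the largest element of the enlarged set, hence determined by it;
       removing it recovers [x]. *)
    assert (Hcc : c x = c y).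
    { destruct (proj2 Ord_l (c x) (c y)) as [H|[H|H]]; auto; exfalso.
      - destruct (proj2 (K (c y))) as [H'|H']; auto.
        + apply H2, (Ord_trans l) with (c y); auto; apply Ord_l.
        + rewrite H' in H; exact (mem_irrefl _ H).
      - destruct (proj1 (K (c x))) as [H'|H']; auto.
        + apply H4, (Ord_trans l) with (c x); auto; apply Ord_l.
        + rewrite H' in H; exact (mem_irrefl _ H). }
    apply ext; intros z; split; intros Hz.
    - destruct (proj1 (K z)) as [H|H]; auto.
      destruct H2; rewrite Hcc, <- H; auto.
    - destruct (proj2 (K z)) as [H|H]; auto.
      destruct H4; rewrite <- Hcc, <- H; auto. }
  (* Members of [k] code themselves; injectivity survives because [S0] avoids [k]. *)
  set (s := fun x => ite (x ∈ k) x (S0 x)).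
  assert (Hs : DefF s) by (unfold s, ite, S0; df).
  assert (HsP : forall x, x ∈ P -> (x ∈ k /\ s x = x) \/ (~ x ∈ k /\ s x = S0 x)).
  { intros x Hx; unfold s; destruct (classic (x ∈ k));
      [left; rewrite ite_true|right; rewrite ite_false]; auto. }
  exists (lam P s); split; [split|split].
  - intros x Hx; rewrite ap_lam by auto; destruct (HsP x Hx) as [[H ->]|[H ->]].
    + apply k_sub_l, H.
    + apply HS0, Hx.
  - intros x y Hx Hy; rewrite !ap_lam by auto.
    destruct (HsP x Hx) as [[H ->]|[H ->]], (HsP y Hy) as [[H' ->]|[H' ->]]; intros He'.
    + exact He'.
    + destruct (HS0 y Hy) as (_ & _ & []); rewrite <- He'; exact H.
    + destruct (HS0 x Hx) as (_ & _ & []); rewrite He'; exact H'.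
    + exact (HS0i x y Hx Hy He').
  - intros x Hx; rewrite ap_lam by auto; destruct (HsP x Hx) as [[H ->]|[H ->]];
      intros z Hz; auto.
    destruct (HS0 x Hx) as (H1 & H2 & _), (Hbs x Hx) as [B1 B2].
    apply B2 in Hz; destruct (proj2 Ord_l (S0 x) (b x) H1 B1) as [?|[->|?]]; auto;
      [contradiction|].
    apply (Ord_trans l) with (b x); auto; apply Ord_l.
  - intros a Ha; assert (a ∈ P).
    { apply in_P; split; [apply l_trans, k_sub_l; auto|apply small_ord; auto]. }
    rewrite ap_lam by auto; unfold s; apply ite_true, Ha.
Qed.

Section Coding.

Variable s : N.
Hypothesis s_inj : injF (ap s) P l.
Hypothesis s_sub : forall x, x ∈ P -> Sub x (ap s x).
Hypothesis s_k : forall a, a ∈ k -> ap s a = a.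

(** ** The urelement model *)

Definition umem a b := exists y, y ∈ P /\ b = ap s y /\ a ∈ y.
Definition urel a := forall y, y ∈ P -> a <> ap s y.
Definition elts a := sep l (fun z => umem z a).

Lemma umem_code x z : x ∈ P -> (umem z (ap s x) <-> z ∈ x).
Proof.
  intros Hx; split.
  - intros (y & Hy & He & Hz); apply s_inj in He; auto; congruence.
  - intros Hz; exists x; auto.
Qed.

Lemma in_elts a z : z ∈ elts a <-> umem z a.
Proof.
  unfold elts; rewrite in_sep by (unfold umem; df); split; [tauto|].
  intros H; split; auto; destruct H as (y & Hy & _ & Hz); apply (P_l y); auto.
Qed.

Lemma elts_code x : x ∈ P -> elts (ap s x) = x.
Proof. intros Hx; apply ext; intros z; rewrite in_elts; apply umem_code, Hx. Qed.

(** Urelements have no elements and decode to [empty], so later closure arguments need not separate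
    them from sets. *)
Lemma elts_P a : elts a ∈ P.
Proof.
  destruct (classic (exists y, y ∈ P /\ a = ap s y)) as [(y & Hy & ->)|H].
  - rewrite elts_code; auto.
  - apply P_sub with empty; [|apply in_P; split].
    + intros z Hz; apply in_elts in Hz as (y & Hy & He & _); destruct H; eauto.
    + intros z Hz; destruct (in_empty z Hz).
    + apply small_ord, empty_in_k.
Qed.

Lemma k_in_P a : a ∈ k -> a ∈ P.
Proof.
  intros Ha; apply in_P; split; [apply l_trans, k_sub_l, Ha|apply small_ord, Ha].
Qed.

Lemma umem_k a z : a ∈ k -> (umem z a <-> z ∈ a).
Proof. intros Ha; rewrite <- (s_k a Ha) at 1; apply umem_code, k_in_P, Ha. Qed.

(** * Satisfaction inside [N] and Łoś's theorem *)

Fixpoint nsat (z : N) (p : uform) (r S : nat -> N) : Prop :=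
  match p with
  | uBot => False
  | uUr x => urel (r x)
  | uMem x y => umem (r x) (r y)
  | uEq x y => r x = r y
  | uCMem x X => r x ∈ S X
  | uCEq X Y => S X = S Y
  | uImp p q => nsat z p r S -> nsat z q r S
  | uAll p => forall a, a ∈ z -> nsat z p (scons a r) S
  | uCAll p => forall A, Sub A z -> nsat z p r (scons A S)
  end.

(** [nsat l] is truth in the whole model, and [nsat z] is truth relativized to the set coded from
    [z]. Class quantifiers range over elements of [N], so each fixed [p] is first-order there; this
    serves both comprehension and the ultrafilter dichotomy. *)
Lemma Df_nsat p : forall (z : (nat -> N) -> N) (R S : nat -> (nat -> N) -> N),
  Tm z -> (forall i, Tm (R i)) -> (forall i, Tm (S i)) ->
  Df (fun ρ => nsat (z ρ) p (fun i => R i ρ) (fun i => S i ρ)).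
Proof.
  assert (K : forall R : nat -> (nat -> N) -> N, (forall i, Tm (R i)) -> forall i,
    Tm (fun ρ => scons (ρ 0) (fun j => R j (fun n => ρ (Datatypes.S n))) i)).
  { intros R HR [|i]; simpl; [apply Tm_var|apply (Tm_weak (R i)), HR]. }
  induction p as [|x|x y|x y|x X|X Y|p IHp q IHq|p IHp|p IHp]; intros z R S Hz HR HS;
    cbn [nsat].
  - apply Df_const.
  - apply (Df_app1 urel); auto; unfold urel; df.
  - apply (Df_app2 umem); auto; unfold umem; df.
  - apply Df_eq; auto.
  - apply Df_mem; auto.
  - apply Df_eq; auto.
  - apply Df_imp; auto.
  - apply Df_all, Df_imp; [apply Df_mem; [apply Tm_var|apply (Tm_weak z), Hz]|].
    apply (IHp (fun ρ => z (fun n => ρ (Datatypes.S n)))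
      (fun i ρ => scons (ρ 0) (fun j => R j (fun n => ρ (Datatypes.S n))) i)
      (fun i ρ => S i (fun n => ρ (Datatypes.S n)))); auto.
    + apply (Tm_weak z), Hz.
    + intros i; apply (Tm_weak (S i)), HS.
  - apply Df_all, Df_imp.
    + apply (Df_app2 Sub); [unfold Sub; df|apply Tm_var|apply (Tm_weak z), Hz].
    + apply (IHp (fun ρ => z (fun n => ρ (Datatypes.S n)))
        (fun i ρ => R i (fun n => ρ (Datatypes.S n)))
        (fun i ρ => scons (ρ 0) (fun j => S j (fun n => ρ (Datatypes.S n))) i)); auto.
      * apply (Tm_weak z), Hz.
      * intros i; apply (Tm_weak (R i)), HR.
Qed.

Lemma scons_map {A B} (f : A -> B) a r :
  (fun i => f (scons a r i)) = scons (f a) (fun i => f (r i)).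
Proof. apply functional_extensionality; intros [|i]; reflexivity. Qed.

Lemma Uae_nsat_def p r S : Def1 (fun z => nsat z p r (fun i => cap (S i) z)).
Proof.
  apply (Df_nsat p (fun ρ => ρ 0) (fun i _ => r i) (fun i ρ => cap (S i) (ρ 0)));
    intros; df.
Qed.

(* In the class quantifier step, choose for almost every [z] a counterexample
   [ap f z ⊆ z]; by normality [ap f z = B ∩ z] almost everywhere, where [B] collects
   the elements that belong to almost all [ap f z]. *)
Lemma los_theorem p : forall r S, (forall i, r i ∈ l) -> (forall i, Sub (S i) l) ->
  (nsat l p r S <-> Uae (fun z => nsat z p r (fun i => cap (S i) z))).
Proof.
  assert (Hconst : forall Q : Prop, Q <-> Uae (fun _ => Q)).
  { intros Q; split; [intros H; apply Uae_all; auto|].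
    intros H; apply Uae_ex in H as (z & _ & H); exact H. }
  induction p as [|x|x y|x y|x X|X Y|p IHp q IHq|p IHp|p IHp]; intros r S Hr HS; cbn [nsat];
    try exact (Hconst _).
  - split.
    + intros H; generalize (Uae_fine (r x) (Hr x)); apply Uae_mono; intros z _ Hz.
      apply in_cap; auto.
    + intros H; apply Uae_ex in H as (z & _ & H); apply in_cap in H; tauto.
  - split; [intros ->; apply Uae_all; auto|].
    intros H; apply ext; intros a; split; intros Ha;
      destruct (Uae_ex _ (Uae_and _ _ H (Uae_fine a (HS _ a Ha)))) as (z & _ & He & Hz);
      [assert (H' : a ∈ cap (S Y) z) by (rewrite <- He; apply in_cap; auto)
      |assert (H' : a ∈ cap (S X) z) by (rewrite He; apply in_cap; auto)];
      apply in_cap in H'; tauto.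
  - rewrite IHp, IHq by auto; split.
    + intros H; destruct (Uae_em _ (Uae_nsat_def p r S)) as [Hp|Hp].
      * generalize (H Hp); apply Uae_mono; auto.
      * revert Hp; apply Uae_mono; tauto.
    + intros H H'; generalize (Uae_and _ _ H H'); apply Uae_mono; tauto.
  - assert (IH : forall a, a ∈ l -> (nsat l p (scons a r) S <->
      Uae (fun z => nsat z p (scons a r) (fun i => cap (S i) z)))).
    { intros a Ha; apply IHp; auto; intros [|i]; simpl; auto. }
    split.
    (* A diagonal intersection handles all [a ∈ z] together; conversely each fixed [a] lies in
       almost every [z] by fineness. *)
    + intros H; apply (Uae_normal (fun a z => nsat z p (scons a r) (fun i => cap (S i) z))).
      * apply (Df_nsat p (fun ρ => ρ 1) (fun i ρ => scons (ρ 0) r i)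
          (fun i ρ => cap (S i) (ρ 1))); intros; [df| |df].
        destruct i; simpl; df.
      * intros a Ha; apply IH; auto.
    + intros H a Ha; apply IH; auto.
      generalize (Uae_and _ _ H (Uae_fine a Ha)); apply Uae_mono; intros z _ [H1 H2]; auto.
  - assert (IH : forall A, Sub A l -> (nsat l p r (scons A S) <->
      Uae (fun z => nsat z p r (scons (cap A z) (fun i => cap (S i) z))))).
    { intros A HA; rewrite IHp; auto; [|intros [|i]; simpl; auto].
      split; apply Uae_mono; intros z _; rewrite (scons_map (fun x => cap x z)); auto. }
    assert (HD : Def2 (fun z A => Sub A z /\ ~ nsat z p r (scons A (fun i => cap (S i) z)))).
    { apply Df_and; [unfold Sub; df|apply Df_not].
      apply (Df_nsat p (fun ρ => ρ 0) (fun i _ => r i)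
        (fun i ρ => scons (ρ 1) (fun i => cap (S i) (ρ 0)) i)); intros; [df|df|].
      destruct i; simpl; df. }
    split.
    + intros H.
      destruct (Uae_em (fun z => forall A, Sub A z -> nsat z p r (scons A (fun i => cap (S i) z))))
        as [H'|H']; auto.
      { apply (Df_nsat (uCAll p) (fun ρ => ρ 0) (fun i _ => r i) (fun i ρ => cap (S i) (ρ 0)));
          intros; df. }
      exfalso.
      set (Bad := sep P (fun z => exists A, Sub A z /\
        ~ nsat z p r (scons A (fun i => cap (S i) z)))).
      assert (HBad : forall z, z ∈ Bad <-> z ∈ P /\ exists A, Sub A z /\
        ~ nsat z p r (scons A (fun i => cap (S i) z))).
      { intros z; apply in_sep, Df_ex.
        exact (Df_rename (fun n => match n with 0 => 1 | _ => 0 end) _ HD). }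
      destruct (choice Bad (pow l) _ HD) as [f Hf].
      { intros z Hz; apply HBad in Hz as (Hz & A & HA & HnA); exists A; split; auto.
        apply in_pow; intros a Ha; apply (P_l z); auto. }
      assert (HU : Uae (fun z => Sub (ap f z) z /\
        ~ nsat z p r (scons (ap f z) (fun i => cap (S i) z)))).
      { revert H'; apply Uae_mono; intros z Hz Hn; apply Hf, HBad; split; auto.
        apply not_all_ex_not in Hn as [A HA]; apply imply_to_and in HA; eauto. }
      set (B := sep l (fun a => Uae (fun z => a ∈ ap f z))).
      assert (inB : forall a, a ∈ B <-> a ∈ l /\ Uae (fun z => a ∈ ap f z)).
      { intros a; unfold B; apply (in_sep (fun a => Uae (fun z => a ∈ ap f z))).
        unfold Uae; df. }
      assert (HB : Uae (fun z => forall a, a ∈ z -> (a ∈ ap f z <-> a ∈ B))).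
      { apply (Uae_normal (fun a z => a ∈ ap f z <-> a ∈ B)); [df|].
        intros a Ha; destruct (Uae_em (fun z => a ∈ ap f z)) as [Q|Q]; [df| |].
        - assert (a ∈ B) by (apply inB; auto); revert Q; apply Uae_mono; tauto.
        - assert (~ a ∈ B) by (intros Hb; apply inB in Hb as [_ Hb]; exact (Uae_not _ Hb Q)).
          revert Q; apply Uae_mono; tauto. }
      assert (HBl : Sub B l) by (intros a Ha; apply inB in Ha; tauto).
      apply (Uae_not _ (proj1 (IH B HBl) (H B HBl))).
      generalize (Uae_and _ _ HU HB); apply Uae_mono; intros z _ [[H1 H2] H3].
      replace (cap B z) with (ap f z); auto.
      apply ext; intros a; rewrite in_cap; split; [intros Ha; split; auto; apply H3; auto|].
      intros [Ha Haz]; apply H3; auto.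
    + intros H A HA; apply IH; auto; revert H; apply Uae_mono; intros z _ H; apply H.
      intros a Ha; apply in_cap in Ha; tauto.
Qed.

(** * The axioms in the urelement model *)

Definition ur_model : ustruct := {|
  obj := { a : N | a ∈ l };
  cls := { X : N | Sub X l };
  ur := fun a => urel (proj1_sig a);
  mem := fun a b => umem (proj1_sig a) (proj1_sig b);
  cmem := fun a X => proj1_sig a ∈ proj1_sig X |}.

Definition oval (a : obj ur_model) : N := proj1_sig a.
Definition cval (X : cls ur_model) : N := proj1_sig X.

Lemma oval_l a : oval a ∈ l.
Proof. exact (proj2_sig a). Qed.

Lemma cval_l X : Sub (cval X) l.
Proof. exact (proj2_sig X). Qed.

Lemma oval_inj a b : oval a = oval b -> a = b.
Proof. intros H; apply eq_sig_hprop; [intros; apply proof_irrelevance|exact H]. Qed.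

Lemma cval_inj a b : cval a = cval b -> a = b.
Proof. intros H; apply eq_sig_hprop; [intros; apply proof_irrelevance|exact H]. Qed.

Lemma obj_of a : a ∈ l -> exists x : obj ur_model, oval x = a.
Proof. intros Ha; exists (exist _ a Ha); reflexivity. Qed.

Lemma cls_of X : Sub X l -> exists Y : cls ur_model, cval Y = X.
Proof. intros HX; exists (exist _ X HX); reflexivity. Qed.

Lemma usat_nsat z (D : obj ur_model -> Prop) (C : cls ur_model -> Prop) p :
  (forall a, D a <-> oval a ∈ z) -> (forall X, C X <-> Sub (cval X) z) -> Sub z l ->
  forall r S, usat_in ur_model D C p r S <-> nsat z p (fun i => oval (r i)) (fun i => cval (S i)).
Proof.
  intros HD HC Hz.
  induction p as [|x|x y|x y|x X|X Y|p IHp q IHq|p IHp|p IHp]; intros r S; cbn [nsat usat_in];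
    try reflexivity.
  - split; [intros ->; reflexivity|apply oval_inj].
  - split; [intros ->; reflexivity|apply cval_inj].
  - rewrite IHp, IHq; reflexivity.
  - split.
    + intros H a Ha; destruct (obj_of a (Hz a Ha)) as [x <-].
      rewrite <- scons_map; apply IHp, H, HD, Ha.
    + intros H a Ha; apply IHp; rewrite scons_map; apply H, HD, Ha.
  - split.
    + intros H A HA; destruct (cls_of A) as [X <-]; [intros a Ha; auto|].
      rewrite <- scons_map; apply IHp, H, HC, HA.
    + intros H A HA; apply IHp; rewrite scons_map; apply H, HC, HA.
Qed.

(** Łoś's theorem intersects every class value with [z], but [RP2] does so only for class variable
    0; the two valuations agree on the free variables of the formula. *)
Lemma nsat_bounded z p : forall n m r r' S S', ubounded n m p ->
  (forall i, i < n -> r i = r' i) -> (forall i, i < m -> S i = S' i) ->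
  (nsat z p r S <-> nsat z p r' S').
Proof.
  assert (K : forall (f g : nat -> N) n a, (forall i, i < n -> f i = g i) ->
    forall i, i < Datatypes.S n -> scons a f i = scons a g i).
  { intros f g n a H [|i] Hi; simpl; auto; apply H; lia. }
  induction p as [|x|x y|x y|x X|X Y|p IHp q IHq|p IHp|p IHp]; intros n m r r' S S' Hb Hr HS;
    cbn [nsat]; simpl in Hb.
  - reflexivity.
  - rewrite Hr by tauto; reflexivity.
  - rewrite !Hr by tauto; reflexivity.
  - rewrite !Hr by tauto; reflexivity.
  - rewrite Hr, HS by tauto; reflexivity.
  - rewrite !HS by tauto; reflexivity.
  - rewrite (IHp n m r r' S S'), (IHq n m r r' S S') by tauto; reflexivity.
  - assert (IH : forall a, nsat z p (scons a r) S <-> nsat z p (scons a r') S').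
    { intros a; apply (IHp (Datatypes.S n) m); [tauto|apply K, Hr|exact HS]. }
    split; intros H a Ha; apply IH, H, Ha.
  - assert (IH : forall A, nsat z p r (scons A S) <-> nsat z p r' (scons A S')).
    { intros A; apply (IHp n (Datatypes.S m)); [tauto|exact Hr|apply K, HS]. }
    split; intros H A HA; apply IH, H, HA.
Qed.

Lemma set_of x : x ∈ P ->
  exists y : obj ur_model, oval y = ap s x /\ is_set ur_model y /\ forall z : obj ur_model, mem z y <-> oval z ∈ x.
Proof.
  intros Hx; destruct (obj_of (ap s x)) as [y Hy]; [apply s_inj, Hx|].
  exists y; split; auto; split.
  - intros H; apply (H x); auto.
  - intros z; change (mem z y) with (umem (oval z) (oval y)); rewrite Hy; apply umem_code, Hx.
Qed.

Lemma set_code (a : obj ur_model) : is_set ur_model a -> exists x, x ∈ P /\ oval a = ap s x.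
Proof.
  intros H; apply NNPP; intros Hn; apply H; intros x Hx He; apply Hn; eauto.
Qed.

Lemma mem_elts (z x : obj ur_model) : mem z x <-> oval z ∈ elts (oval x).
Proof. rewrite in_elts; reflexivity. Qed.

Lemma mem_code (z a : obj ur_model) x : x ∈ P -> oval a = ap s x -> (mem z a <-> oval z ∈ x).
Proof. intros Hx Ha; rewrite mem_elts, Ha, elts_code; tauto. Qed.

Definition code_pair a b := ap s (upr (ap s (upr a a)) (ap s (upr a b))).

Lemma code_pair_l a b : a ∈ l -> b ∈ l -> code_pair a b ∈ l.
Proof. intros Ha Hb; apply s_inj, P_upr; apply s_inj, P_upr; auto. Qed.

Lemma code_pair_inj a b c d : a ∈ l -> b ∈ l -> c ∈ l -> d ∈ l -> code_pair a b = code_pair c d -> a = c /\ b = d.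
Proof.
  intros Ha Hb Hc Hd H; apply s_inj in H; try (apply P_upr; apply s_inj, P_upr; auto).
  assert (K : pr a b = pr c d).
  { unfold pr; apply upr_inj in H as [[H1 H2]|[H1 H2]];
      apply s_inj in H1, H2; try (apply P_upr; auto); rewrite H1, H2; auto.
    apply ext; intros z; rewrite !in_upr; tauto. }
  apply pr_inj, K.
Qed.

Lemma DefF2_code_pair : DefF2 code_pair.
Proof. unfold code_pair; df. Qed.

Lemma upair_iff (p x y : obj ur_model) : upair ur_model p x y <-> oval p = ap s (upr (oval x) (oval y)).
Proof.
  assert (HP2 : upr (oval x) (oval y) ∈ P) by (apply P_upr; apply oval_l).
  split.
  (* [upair] does not say that [p] is a set, but an object with a member is a code. *)
  - intros H; destruct (proj2 (H x)) as (u & Hu & Hp & _); auto.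
    change (oval p = ap s u) in Hp; rewrite Hp; f_equal; apply ext; intros z; split.
    + intros Hz; destruct (obj_of z) as [w <-]; [apply (P_l u); auto|].
      apply (mem_code w p u), H in Hz as [->| ->]; auto; apply in_upr; auto.
    + intros Hz; apply in_upr in Hz as [->| ->]; apply (mem_code _ p u); auto; apply H; auto.
  - intros Hp z; rewrite (mem_code z p _ HP2 Hp), in_upr.
    split; (intros [H|H]; [left|right]); try (apply oval_inj; exact H); rewrite H; auto.
Qed.

Lemma opair_iff (p x y : obj ur_model) : opair ur_model p x y <-> oval p = code_pair (oval x) (oval y).
Proof.
  unfold opair, code_pair; split.
  - intros (a & b & Ha & Hb & Hp); rewrite upair_iff in *; congruence.
  - intros H; destruct (set_of (upr (oval x) (oval x))) as (a & Ha & _); [apply P_upr; apply oval_l|].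
    destruct (set_of (upr (oval x) (oval y))) as (b & Hb & _); [apply P_upr; apply oval_l|].
    exists a, b; rewrite !upair_iff; rewrite Ha, Hb; auto.
Qed.

Lemma cpair_iff (x y : obj ur_model) F : cpair ur_model x y F <-> code_pair (oval x) (oval y) ∈ cval F.
Proof.
  unfold cpair; split.
  - intros (p & Hp & H); apply opair_iff in Hp; rewrite <- Hp; exact H.
  - intros H; destruct (obj_of (code_pair (oval x) (oval y))) as [p Hp]; [apply code_pair_l; apply oval_l|].
    exists p; rewrite opair_iff; split; auto; change (oval p ∈ cval F); rewrite Hp; exact H.
Qed.

Lemma zu_holds : ZU ur_model.
Proof.
  constructor.
  - intros a x H (y & Hy & He & _); exact (H y Hy He).
  - intros x y Hx Hy H; apply set_code in Hx as (u & Hu & Hxu), Hy as (v & Hv & Hyv).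
    apply oval_inj; rewrite Hxu, Hyv; f_equal; apply ext; intros z; split; intros Hz.
    + destruct (obj_of z) as [w <-]; [apply (P_l u); auto|].
      apply (mem_code w y v), H, (mem_code w x u); auto.
    + destruct (obj_of z) as [w <-]; [apply (P_l v); auto|].
      apply (mem_code w x u), H, (mem_code w y v); auto.
  (* An [∈]-minimal element in [N] is also minimal for [umem], because [u ⊆ s(u)] turns membership
     in a coded set into [∈]. *)
  - intros x [y Hy]; destruct (foundation (elts (oval x))) as (a & Ha & Hm).
    + intros He; apply (He (oval y)), mem_elts, Hy.
    + destruct (obj_of a) as [z <-]; [apply (P_l (elts (oval x))); auto; apply elts_P|].
      exists z; split; [apply mem_elts, Ha|].
      intros w Hw (u & Hu & He & Hwu); apply (Hm (oval w)); [apply mem_elts, Hw|].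
      change (oval z = ap s u) in He; rewrite He; apply s_sub; auto.
  - intros x y; destruct (set_of (upr (oval x) (oval y))) as (p & Hp & Hs & _);
      [apply P_upr; apply oval_l|].
    exists p; split; auto; apply upair_iff, Hp.
  - intros x.
    assert (Hexts : DefF elts) by (unfold elts, umem; df).
    destruct (set_of (Un (im (elts (oval x)) elts))) as (u & _ & Hs & Hu).
    { apply P_union; auto; [apply in_P, elts_P|intros; apply elts_P]. }
    exists u; split; auto; intros z; rewrite Hu, in_Un; split.
    + intros (y & Hy & Hz); rewrite in_im in Hy by auto; destruct Hy as (w & Hw & ->).
      destruct (obj_of w) as [y <-]; [apply (P_l (elts (oval x))); auto; apply elts_P|].
      exists y; rewrite !mem_elts; auto.
    + intros (y & Hy & Hz); exists (elts (oval y)); rewrite mem_elts in *; split; auto.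
      apply im_intro; auto.
  - intros x.
    (* There are few enough subsets because [k] is a strong limit, and all have codes because [P] is
       closed under subsets. *)
    destruct (set_of (im (pow (elts (oval x))) (ap s))) as (p & _ & Hs & Hp).
    { apply in_P; split.
      - intros y Hy; rewrite in_im in Hy by df; destruct Hy as (u & Hu & ->).
        apply s_inj, P_sub with (elts (oval x)); [apply in_pow, Hu|apply elts_P].
      - apply small_im; [df|]; apply small_pow, in_P, elts_P. }
    exists p; split; auto; intros y; rewrite Hp, in_im by df; split.
    + intros (u & Hu & Hy); apply in_pow in Hu.
      assert (HuP : u ∈ P) by (apply P_sub with (elts (oval x)); [exact Hu|apply elts_P]).
      split; [intros H; exact (H u HuP Hy)|].
      intros z Hz; apply (mem_code z y u) in Hz; auto; apply mem_elts; auto.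
    + intros [Hy H]; apply set_code in Hy as (u & Hu & Hy); exists u; split; auto.
      apply in_pow; intros z Hz; destruct (obj_of z) as [w <-]; [apply (P_l u); auto|].
      apply mem_elts, H, (mem_code w y u); auto.
  (* The inductive set below [k] and its elements are their own codes, so it is inductive for [umem]
     as well. *)
  - destruct k_uncountable as [_ (w & [(e & He & Hew) Hw] & Hwk)].
    destruct (set_of w (k_in_P w Hwk)) as (W & _ & Hs & HW).
    assert (K : forall a, a ∈ w -> exists x : obj ur_model, oval x = a /\ is_set ur_model x /\
      forall z : obj ur_model, mem z x <-> oval z ∈ a).
    { intros a Ha; assert (Hak : a ∈ k) by (apply (k_trans w); auto).
      destruct (set_of a (k_in_P a Hak)) as (x & Hx & H); exists x; rewrite s_k in Hx; auto. }
    exists W; split; auto; split.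
    + destruct (K e Hew) as (x & Hx & Hxs & Hm); exists x; split; auto; split.
      * intros z Hz; apply Hm in Hz; exact (He _ Hz).
      * apply HW; rewrite Hx; auto.
    + intros x Hx; apply HW in Hx; destruct (Hw _ Hx) as (a & Ha & Haw).
      destruct (K a Haw) as (y & Hy & _ & Hm); exists y; split.
      * intros z; rewrite Hm, (Ha (oval z)).
        change (mem z x) with (umem (oval z) (oval x)); rewrite umem_k by (apply (k_trans w); auto).
        split; (intros [H|H]; [left|right]); auto; [apply oval_inj, H|rewrite H; auto].
      * apply HW; rewrite Hy; auto.
  - intros x Y; destruct (set_of (cap (elts (oval x)) (cval Y))) as (y & _ & Hs & Hy).
    { apply P_sub with (elts (oval x)); [|apply elts_P]; intros z Hz; apply in_cap in Hz; tauto. }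
    exists y; split; auto; intros z; rewrite Hy, in_cap, mem_elts; reflexivity.
Qed.

Lemma usat_iff p r S : usat ur_model p r S <-> nsat l p (fun i => oval (r i)) (fun i => cval (S i)).
Proof.
  apply usat_nsat.
  - intros a; split; auto; intros _; apply oval_l.
  - intros X; split; auto; intros _; apply cval_l.
  - intros z; auto.
Qed.

Lemma kmcu_holds : KMCU ur_model.
Proof.
  pose proof DefF2_code_pair as Hpair.
  constructor.
  - apply zu_holds.
  - intros X Y H; apply cval_inj, ext; intros z; split; intros Hz;
      (destruct (obj_of z) as [w <-]; [eapply cval_l; eauto|]); apply (H w), Hz.
  - intros F x [_ HF].
    set (Q := fun z => exists w, w ∈ elts (oval x) /\ code_pair w z ∈ cval F).
    assert (HQ : Def1 Q) by (unfold Q; df).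
    (* [G] is [F] made total, with value [empty] where [F] is undefined; the image under [F] is thus
       contained in a small set. *)
    set (G := fun w => iota (fun z => z ∈ l /\ code_pair w z ∈ cval F)).
    assert (HG : DefF G) by (unfold G; df).
    destruct (set_of (sep l Q)) as (y & _ & Hs & Hy).
    { apply in_P; split; [intros z Hz; rewrite in_sep in Hz by auto; tauto|].
      apply small_sub with (im (elts (oval x)) G); [|apply small_im; auto; apply in_P, elts_P].
      intros z Hz; rewrite in_sep in Hz by auto; destruct Hz as [Hz (w & Hw & Hwz)].
      apply in_im; auto; exists w; split; auto; symmetry; apply iota_eq; auto.
      intros z' [Hz' Hwz'].
      destruct (obj_of w) as [a <-]; [apply (P_l (elts (oval x))); auto; apply elts_P|].
      destruct (obj_of z Hz) as [b <-], (obj_of z' Hz') as [c <-].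
      f_equal; apply (HF a); apply cpair_iff; auto. }
    exists y; split; auto; intros z; rewrite Hy, in_sep by auto; split.
    + intros [_ (w & Hw & H)].
      destruct (obj_of w) as [a <-]; [apply (P_l (elts (oval x))); auto; apply elts_P|].
      exists a; rewrite mem_elts, cpair_iff; auto.
    + intros (w & Hw & H); split; [apply oval_l|exists (oval w)].
      rewrite mem_elts, cpair_iff in *; auto.
  - intros p r S.
    set (Q := fun a => nsat l p (scons a (fun i => oval (r i))) (fun i => cval (S i))).
    assert (HQ : Def1 Q).
    { apply (Df_nsat p (fun _ => l) (fun i ρ => scons (ρ 0) (fun i => oval (r i)) i)
        (fun i _ => cval (S i))); intros; [df| |df]; destruct i; simpl; df. }
    destruct (cls_of (sep l Q)) as [X HX].
    { intros z Hz; rewrite in_sep in Hz by auto; tauto. }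
    exists X; intros x; change (cmem x X) with (oval x ∈ cval X).
    rewrite HX, in_sep, usat_iff, scons_map by auto; unfold Q.
    split; [tauto|intros H; split; [apply oval_l|exact H]].
  (* The global well-ordering is [∈] on the ordinal [l], carried by the pairs of the model. *)
  - set (Q := fun p => exists x y, x ∈ l /\ y ∈ l /\ x ∈ y /\ p = code_pair x y).
    assert (HQ : Def1 Q) by (unfold Q; df).
    destruct (cls_of (sep l Q)) as [W HW].
    { intros z Hz; rewrite in_sep in Hz by auto; tauto. }
    assert (KW : forall x y : obj ur_model, cpair ur_model x y W <-> oval x ∈ oval y).
    { intros x y; rewrite cpair_iff, HW, in_sep by auto; split.
      - intros [_ (a & b & Ha & Hb & Hab & He)].
        apply code_pair_inj in He as [-> ->]; auto; apply oval_l.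
      - intros H; split; [apply code_pair_l; apply oval_l|].
        exists (oval x), (oval y); repeat split; auto; apply oval_l. }
    exists W; split; [|split; [|split; [|split]]].
    + intros p Hp; change (oval p ∈ cval W) in Hp; rewrite HW, in_sep in Hp by auto.
      destruct Hp as [_ (a & b & Ha & Hb & _ & He)].
      destruct (obj_of a Ha) as [x <-], (obj_of b Hb) as [y <-]; exists x, y.
      apply opair_iff, He.
    + intros x H; apply KW in H; exact (mem_irrefl _ H).
    + intros x y z; rewrite !KW; apply (Ord_trans l); [apply Ord_l|apply oval_l].
    + intros x y; rewrite !KW.
      destruct (proj2 Ord_l (oval x) (oval y)) as [H|[H|H]]; auto; try apply oval_l.
      right; left; apply oval_inj, H.
    + intros X [x Hx]; destruct (foundation (cval X)) as (a & Ha & Hm).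
      * intros He; exact (He _ Hx).
      * destruct (obj_of a) as [y <-]; [apply (cval_l X); auto|].
        exists y; split; auto; intros z Hz; rewrite KW; apply Hm, Hz.
Qed.

Lemma rp2_holds : RP2 ur_model.
Proof.
  intros p Hp r S X H; apply usat_iff in H.
  apply los_theorem in H; [|intros i; apply oval_l|intros i; apply cval_l].
  (* Each [elts a] is small, hence contained in almost every [z]; normality gives this for all
     [a ∈ z] at once, which is transitivity of the set coded by [s(z)]. *)
  assert (HT : Uae (fun z => forall a, a ∈ z -> Sub (elts a) z)).
  { apply (Uae_normal (fun a z => Sub (elts a) z)); [unfold Sub, elts, umem; df|].
    intros a _; apply Uae_sub, elts_P. }
  destruct (Uae_ex _ (Uae_and _ _ H HT)) as (z & Hz & Hsat & Ht).
  destruct (set_of z Hz) as (t & Hzt & Hts & Htm).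
  destruct (cls_of (cap (cval X) z)) as [Y HY].
  { intros w Hw; apply in_cap in Hw as [Hw _]; apply (cval_l X); auto. }
  exists t; split; [split; auto|].
  - intros x y Hx Hy; apply Htm; apply Htm in Hx; apply (Ht (oval x)); auto; apply mem_elts, Hy.
  - exists Y; split.
    + intros x; change (oval x ∈ cval Y <-> oval x ∈ cval X /\ mem x t).
      rewrite HY, in_cap, Htm; reflexivity.
    + apply (usat_nsat z); auto.
      * intros A; split; intros HA w Hw.
        -- destruct (obj_of w) as [x <-]; [apply (cval_l A); auto|]; apply Htm, HA, Hw.
        -- apply Htm, HA, Hw.
      * apply P_l, Hz.
      * revert Hsat; apply (nsat_bounded z p 0 1); auto.
        intros [|i] Hi; [simpl; auto|lia].
Qed.

(** A class that includes [k] is too large to be a set. A class bijection between [k] and [l] would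
    be an element of [N] and would give [N] an injection of [l] into [k], contradicting that [l] is
    a cardinal. *)
Lemma size_fails : ~ LimitationOfSize ur_model.
Proof.
  intros H.
  destruct (cls_of k k_sub_l) as [K HK], (cls_of l (fun z Hz => Hz)) as [L HL].
  assert (Hpr : forall X, Sub k (cval X) -> proper_class ur_model X).
  { intros X HX (x & Hx & Hm); apply k_not_small, small_sub with (elts (oval x));
      [|apply in_P, elts_P].
    intros z Hz; destruct (obj_of z) as [w <-]; [apply k_sub_l; auto|].
    apply mem_elts, Hm, HX, Hz. }
  destruct (H K L) as (F & HF & HFK & HFL & Hinj).
  { apply Hpr; rewrite HK; intros z; auto. }
  { apply Hpr; rewrite HL; apply k_sub_l. }
  pose proof DefF2_code_pair as Hpair.
  set (Q := fun y x => x ∈ k /\ code_pair x y ∈ cval F).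
  assert (HQ : Def2 Q) by (unfold Q; df).
  (* The inverse of the class bijection, as an operation on [N]; [least] makes it definable. *)
  set (g := fun y => least l (Q y)).
  assert (Hg : forall y : obj ur_model, exists x : obj ur_model, oval x = g (oval y) /\ oval x ∈ k /\ cpair ur_model x y F).
  { intros y; destruct (proj1 (HFL y)) as [x Hxy].
    { change (oval y ∈ cval L); rewrite HL; apply oval_l. }
    assert (Hx : oval x ∈ k) by (rewrite <- HK; apply HFK; eauto).
    destruct (least_spec l (Q (oval y)) (oval x)) as (H1 & [H2 H3] & _).
    - apply Ord_l.
    - df.
    - apply oval_l.
    - split; auto; apply cpair_iff; auto.
    - destruct (obj_of _ H1) as [x' Hx']; exists x'; rewrite cpair_iff, Hx'; auto. }
  apply (l_not_Leq k k_in_l), (Leq_intro g); [unfold g, least; df|split].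
  - intros y Hy; destruct (obj_of y Hy) as [y' <-]; destruct (Hg y') as (x & <- & Hx & _); auto.
  - intros y y' Hy Hy' He; destruct (obj_of y Hy) as [u <-], (obj_of y' Hy') as [u' <-].
    destruct (Hg u) as (x & Hx & _ & Hxu), (Hg u') as (x' & Hx' & _ & Hxu').
    f_equal; apply (proj2 HF x); auto.
    replace x with x'; auto; apply oval_inj; congruence.
Qed.

End Coding.

End Measure.

Hypothesis sc_true : sat E supercompact_succ rho0.

Lemma supercompact_sem : exists k l P,
  isUncountable k /\ isCardSucc l k /\ isPkl P k l /\
  exists U, isMeasure U P k /\ isFine U P l /\ isNormal U P l.
Proof. refine (iff_elim _ _ _ sc_true). sem. Qed.

Lemma ur_model_exists : exists M : ustruct, KMCU M /\ RP2 M /\ ~ LimitationOfSize M.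
Proof.
  destruct supercompact_sem as (k & l & P & Hk & Hl & HP & U & HU & Hf & Hn).
  destruct (coding k l P U Hk Hl HP HU Hf) as (s & Hi & Hs & Hsk).
  exists (ur_model l P s); split; [|split].
  - eapply kmcu_holds; eauto.
  - eapply rp2_holds; eauto.
  - eapply size_fails; eauto.
Qed.

End ZFCModel.

Theorem theorem4p27 :
  consistent (extend ZFC supercompact_succ) ->
  exists M : ustruct, KMCU M /\ RP2 M /\ ~ LimitationOfSize M.
Proof.
  intros H; destruct (completeness _ H) as (N & E & rho & Hs).
  apply (ur_model_exists N E rho); [intros p Hp|]; apply Hs; [left; exact Hp|right; reflexivity].
Qed.
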